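(* Let $\mathbb{A}$ be a category. Composition of $\mathbb{A}$-linkings respects equivalence: if $f,f':S\to T$ and $g,g':T\to U$ are $\mathbb{A}$-linkings with $f$ equivalent to $f'$ and $g$ equivalent to $g'$, then the composite linkings $f;g$ and $f';g':S\to U$ are equivalent.
   Context: Let $\mathbb{A}$ be a category; its objects are called generators. An atom is a generator or the constant $I$. A shape is an expression generated from atoms by binary $\otimes$ and unary dual $(-)^*$; it is identified with its parse tree (leaves labelled by atoms, internal vertices labelled $\otimes$ or $*$; argument edges join a vertex to its arguments). An occurrence of an atom or of $\otimes$ in a shape is positive if it lies under an even number of duals, otherwise negative. $|S|^+$, $|S|^-$ denote the sets of positive and negative leaves of $S$, and $+$ denotes disjoint union. A leaf function $f:S\to T$ is a total function from $|S|^++|T|^-$ to $|S|^-+|T|^+$, viewed as a set of directed edges $l\to f(l)$, together with a label, a morphism of $\mathbb{A}$, on each edge from a generator-labelled leaf. The graph of $f$ is the disjoint union of the parse trees of $S$ and $T$ together with the edges of $f$, undirected. A switching of $f$ is a subgraph of it obtained by deleting exactly one of the two argument edges of each positive $\otimes$ of $S$ and of each negative $\otimes$ of $T$. An $\mathbb{A}$-linking is a leaf function $f:S\to T$ such that (1a) $f$ restricts to a bijection from the generator-labelled leaves in $|S|^++|T|^-$ to the generator-labelled leaves in $|S|^-+|T|^+$; (1b) the label of an edge from a leaf labelled $a$ to a leaf labelled $b$ is a morphism $a\to b$ of $\mathbb{A}$; (2) every switching of $f$ is a tree. Composition: for linkings $f:S\to T$, $g:T\to U$, $f;g:S\to U$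 has an edge $l\to l'$ ($l\in|S|^++|U|^-$, $l'\in|S|^-+|U|^+$) iff there is a finite directed path from $l$ to $l'$ in the union of the edges of $f$ and $g$ on the disjoint union of the leaves of $S,T,U$. If every edge on the path is labelled, with labels $x_1,\dots,x_n$ in order, then $l\to l'$ is labelled by the composite $x_1;\cdots;x_n$ (diagrammatic order) in $\mathbb{A}$; otherwise it is unlabelled. The composite of two linkings is a linking. Two linkings $S\to T$ are similar if one is obtained from the other by changing the target of one edge whose source is an $I$-labelled leaf. Two linkings are equivalent if they are related by the equivalence relation (on linkings $S\to T$) generated by similarity. *)

(* Defs.v *)
From Stdlib Require Import Relations ProofIrrelevance.
From mathcomp Require Import all_boot.

Set Implicit Arguments.
Unset Strict Implicit.
Unset Printing Implicit Defensive.

(* Composition is in diagrammatic order. *)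
Record category := Category {
  ob : Type;
  hom : ob -> ob -> Type;
  idm : forall a, hom a a;
  compm : forall a b c, hom a b -> hom b c -> hom a c;
  compm1l : forall a b (x : hom a b), compm (idm a) x = x;
  compm1r : forall a b (x : hom a b), compm x (idm b) = x;
  compmA : forall a b c d (x : hom a b) (y : hom b c) (z : hom c d),
    compm x (compm y z) = compm (compm x y) z
}.

(* A morphism of A together with its source and target. *)
Inductive arrow (A : category) : Type :=
  Arrow (a b : ob A) of hom a b.

Inductive atom (A : category) : Type :=
  | Gen of ob A
  | Unit.
Arguments Unit {A}.

Inductive ashape (A : category) : Type :=
  | Atom of atom A
  | Tensor of ashape A & ashape A
  | Dual of ashape A.

(* Vertices of the parse tree; [None] is the root of a compound shape. *)
Fixpoint vertex (A : category) (S : ashape A) : finType :=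
  match S with
  | Atom _ => unit
  | Tensor S1 S2 => option (vertex S1 + vertex S2)%type
  | Dual S1 => option (vertex S1)
  end.

Definition root (A : category) (S : ashape A) : vertex S :=
  match S with
  | Atom _ => tt
  | Tensor _ _ => None
  | Dual _ => None
  end.

Inductive symbol (A : category) : Type :=
  | SAtom of atom A
  | STensor
  | SDual.
Arguments STensor {A}.
Arguments SDual {A}.

Fixpoint symbol_at (A : category) (S : ashape A) : vertex S -> symbol A :=
  match S with
  | Atom x => fun _ => SAtom x
  | Tensor S1 S2 => fun v =>
      match v with
      | None => STensor
      | Some (inl v1) => symbol_at v1
      | Some (inr v2) => symbol_at v2
      end
  | Dual S1 => fun v => if v is Some v1 then symbol_at v1 else SDual
  end.

Fixpoint positive (A : category) (S : ashape A) : vertex S -> bool :=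
  match S with
  | Atom _ => fun _ => true
  | Tensor S1 S2 => fun v =>
      match v with
      | None => true
      | Some (inl v1) => positive v1
      | Some (inr v2) => positive v2
      end
  | Dual S1 => fun v => if v is Some v1 then ~~ positive v1 else true
  end.

(* [arg b v w]: there is an argument edge from [v] to [w].  For a tensor,
   [b = false] selects the left argument and [b = true] the right one; the
   unique argument of a dual has [b = false]. *)
Fixpoint arg (A : category) (S : ashape A) (b : bool) : rel (vertex S) :=
  match S with
  | Atom _ => fun _ _ => false
  | Tensor S1 S2 => fun v w =>
      match v, w with
      | None, Some (inl w1) => ~~ b && (w1 == root S1)
      | None, Some (inr w2) => b && (w2 == root S2)
      | Some (inl v1), Some (inl w1) => arg b v1 w1
      | Some (inr v2), Some (inr w2) => arg b v2 w2
      | _, _ => false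
      end
  | Dual S1 => fun v w =>
      match v, w with
      | None, Some w1 => ~~ b && (w1 == root S1)
      | Some v1, Some w1 => arg b v1 w1
      | _, _ => false
      end
  end.

Definition vertex2 (A : category) (S T : ashape A) : finType :=
  (vertex S + vertex T)%type.

Definition symbol2 (A : category) (S T : ashape A) (v : vertex2 S T) : symbol A :=
  match v with inl s => symbol_at s | inr t => symbol_at t end.

(* Signs of T are reversed: the vertices for which [sign2] holds are the
   positive ones of S and the negative ones of T. *)
Definition sign2 (A : category) (S T : ashape A) (v : vertex2 S T) : bool :=
  match v with inl s => positive s | inr t => ~~ positive t end.

Definition arg2 (A : category) (S T : ashape A) (b : bool) : rel (vertex2 S T) :=
  fun v w => match v, w with
  | inl v1, inl w1 => arg b v1 w1
  | inr v2, inr w2 => arg b v2 w2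
  | _, _ => false
  end.

Definition is_leaf (A : category) (s : symbol A) : bool :=
  if s is SAtom _ then true else false.
Definition is_gen (A : category) (s : symbol A) : bool :=
  if s is SAtom (Gen _) then true else false.
Definition is_unit (A : category) (s : symbol A) : bool :=
  if s is SAtom Unit then true else false.
Definition is_tensor (A : category) (s : symbol A) : bool :=
  if s is STensor then true else false.

(* |S|^+ + |T|^- *)
Definition src (A : category) (S T : ashape A) : finType :=
  {v : vertex2 S T | is_leaf (symbol2 v) && sign2 v}.

(* |S|^- + |T|^+ *)
Definition tgt (A : category) (S T : ashape A) : finType :=
  {v : vertex2 S T | is_leaf (symbol2 v) && ~~ sign2 v}.

Record leaf_function (A : category) (S T : ashape A) := LeafFunction {
  target :> {ffun src S T -> tgt S T};
  label : {ffun src S T -> option (arrow A)};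
  labelP : [forall l, isSome (label l) == is_gen (symbol2 (val l))]
}.

(* A switching is given by a choice [d] of the side to delete at each tensor;
   the values of [d] at other vertices are irrelevant. *)
Definition switched_tensor (A : category) (S T : ashape A) (v : vertex2 S T) : bool :=
  is_tensor (symbol2 v) && sign2 v.

Definition switching_arc (A : category) (S T : ashape A) (f : leaf_function S T)
    (d : vertex2 S T -> bool) : rel (vertex2 S T) := fun v w =>
  [|| [exists b, arg2 b v w && ~~ (switched_tensor v && (d v == b))]
    | [exists l, (val l == v) && (val (f l) == w)]].

Definition switching (A : category) (S T : ashape A) (f : leaf_function S T)
    (d : vertex2 S T -> bool) : rel (vertex2 S T) := fun v w =>
  switching_arc f d v w || switching_arc f d w v.

(* Used for symmetric loopless adjacency relations: a simple cycle of a graph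
   has at least three vertices.  The graph of a leaf function has no parallel
   edges, so its adjacency relation determines it. *)
Definition is_tree (V : finType) (e : rel V) : Prop :=
  (forall x y, connect e x y) /\ (forall c : seq V, ucycle e c -> size c < 3).

Definition gen_bijection (A : category) (S T : ashape A) (f : leaf_function S T) : Prop :=
  [/\ forall l, is_gen (symbol2 (val l)) -> is_gen (symbol2 (val (f l))),
      forall l1 l2, is_gen (symbol2 (val l1)) -> is_gen (symbol2 (val l2)) ->
        f l1 = f l2 -> l1 = l2
    & forall m : tgt S T, is_gen (symbol2 (val m)) ->
        exists2 l, is_gen (symbol2 (val l)) & f l = m].

Definition well_labelled (A : category) (S T : ashape A) (f : leaf_function S T) : Prop :=
  forall (l : src S T) (a b : ob A),
    symbol2 (val l) = SAtom (Gen a) -> symbol2 (val (f l)) = SAtom (Gen b) ->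
    exists x : hom a b, label f l = Some (Arrow x).

Definition is_linking (A : category) (S T : ashape A) (f : leaf_function S T) : Prop :=
  [/\ gen_bijection f, well_labelled f & forall d, is_tree (switching f d)].

Record linking (A : category) (S T : ashape A) := Linking {
  leaf_fun :> leaf_function S T;
  linkingP : is_linking leaf_fun
}.

Definition similar (A : category) (S T : ashape A) (f f' : linking S T) : Prop :=
  exists l : src S T,
    [/\ is_unit (symbol2 (val l)), f l <> f' l,
        forall l', l' <> l -> f l' = f' l' & label f = label f'].

Definition equivalent (A : category) (S T : ashape A) : linking S T -> linking S T -> Prop :=
  clos_refl_sym_trans (linking S T) (@similar A S T).

Definition vertex3 (A : category) (S T U : ashape A) : finType :=
  (vertex S + vertex T + vertex U)%type.

Definition inST (A : category) (S T U : ashape A) (v : vertex2 S T) : vertex3 S T U :=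
  inl v.
Definition inTU (A : category) (S T U : ashape A) (v : vertex2 T U) : vertex3 S T U :=
  match v with inl t => inl (inr t) | inr u => inr u end.
Definition inSU (A : category) (S T U : ashape A) (v : vertex2 S U) : vertex3 S T U :=
  match v with inl s => inl (inl s) | inr u => inr u end.

Inductive union_edge (A : category) (S T U : ashape A)
    (f : leaf_function S T) (g : leaf_function T U) :
    vertex3 S T U -> option (arrow A) -> vertex3 S T U -> Prop :=
  | union_edge_l (l : src S T) :
      union_edge f g (inST U (val l)) (label f l) (inST U (val (f l)))
  | union_edge_r (l : src T U) :
      union_edge f g (inTU S (val l)) (label g l) (inTU S (val (g l))).

(* Nonempty directed paths, with the sequence of their labels. *)
Inductive union_path (A : category) (S T U : ashape A)
    (f : leaf_function S T) (g : leaf_function T U) :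
    vertex3 S T U -> seq (option (arrow A)) -> vertex3 S T U -> Prop :=
  | union_path1 v o w :
      union_edge f g v o w -> union_path f g v [:: o] w
  | union_pathS u o v s w :
      union_edge f g u o v -> union_path f g v s w -> union_path f g u (o :: s) w.

(* [composite_arrow s z]: the arrows in [s] are consecutive and [z] is their
   composite. *)
Inductive composite_arrow (A : category) : seq (arrow A) -> arrow A -> Prop :=
  | composite_arrow1 a b (x : hom a b) :
      composite_arrow [:: Arrow x] (Arrow x)
  | composite_arrowS a b c (x : hom a b) (y : hom b c) s :
      composite_arrow s (Arrow y) ->
      composite_arrow (Arrow x :: s) (Arrow (compm x y)).

Inductive composite_label (A : category) :
    seq (option (arrow A)) -> option (arrow A) -> Prop :=
  | composite_labelled (s : seq (arrow A)) (z : arrow A) :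
      composite_arrow s z -> composite_label (map Some s) (Some z)
  | composite_unlabelled (s : seq (option (arrow A))) :
      ~~ all isSome s -> composite_label s None.

(* [h] is f;g.  By [is_composite_uniq] below this determines [h]. *)
Definition is_composite (A : category) (S T U : ashape A)
    (f : linking S T) (g : linking T U) (h : linking S U) : Prop :=
  (forall (l : src S U) (m : tgt S U),
     h l = m <-> exists s, union_path f g (inSU T (val l)) s (inSU T (val m))) /\
  (forall (l : src S U) s,
     union_path f g (inSU T (val l)) s (inSU T (val (h l))) ->
     composite_label s (label h l)).

Definition arrow_comp (A : category) (x y z : arrow A) : Prop :=
  exists a b c (u : hom a b) (v : hom b c),
    [/\ x = Arrow u, y = Arrow v & z = Arrow (compm u v)].

Lemma arrow_comp_fun (A : category) (x y z z' : arrow A) :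
  arrow_comp x y z -> arrow_comp x y z' -> z = z'.
Proof.
move=> [a [b [c [u [v [-> -> ->]]]]]] [a' [b' [c' [u' [v' [Eu Ev ->]]]]]].
pose dom (w : arrow A) := let: @Arrow _ d _ _ := w in d.
pose cod (w : arrow A) := let: @Arrow _ _ d _ := w in d.
have Ea : a = a' := congr1 dom Eu.
have Eb : b = b' := congr1 cod Eu.
have Ec : c = c' := congr1 cod Ev.
move: u' v' Eu Ev; rewrite -Ea -Eb -Ec => u' v' Eu Ev.
have inj d e (p q : @hom A d e) : Arrow p = Arrow q -> p = q.
  pose pack (w : arrow A) : {d1 : ob A & {e1 : ob A & hom d1 e1}} :=
    let: @Arrow _ d1 e1 r := w in existT _ d1 (existT _ e1 r).
  by move=> /(congr1 pack) E; exact: inj_pair2 _ _ _ _ _ (inj_pair2 _ _ _ _ _ E).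
by rewrite (inj _ _ _ _ Eu) (inj _ _ _ _ Ev).
Qed.

Lemma composite_arrow_fun (A : category) (s : seq (arrow A)) z z' :
  composite_arrow s z -> composite_arrow s z' -> z = z'.
Proof.
elim: s z z' => [|x s IH] z z' H H'; first by inversion H.
case: s IH H H' => [|y s] IH H H'.
  inversion H as [? ? ? E1 E2|? ? ? ? ? ? N]; last by inversion N.
  by inversion H' as [? ? ? E1' E2'|? ? ? ? ? ? N']; [congruence|inversion N'].
have P w : composite_arrow [:: x, y & s] w ->
    exists2 t, composite_arrow (y :: s) t & arrow_comp x t w.
  move=> Hw; inversion Hw as [|a b c p q r Hr E1 E2]; subst.
  by exists (Arrow q) => //; exists a, b, c, p, q.
have [t Ht C] := P _ H; have [t' Ht' C'] := P _ H'.
by apply: (arrow_comp_fun C); rewrite (IH _ _ Ht Ht').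
Qed.

Lemma composite_label_fun (A : category) (s : seq (option (arrow A))) o o' :
  composite_label s o -> composite_label s o' -> o = o'.
Proof.
have inj (s1 s2 : seq (arrow A)) : map Some s1 = map Some s2 -> s1 = s2.
  by elim: s1 s2 => [|x s1 IH] [|y s2] //= [-> /IH ->].
have allS (s1 : seq (arrow A)) : all isSome (map Some s1) by elim: s1.
case=> [s1 z Hz|s1 N] H'.
  inversion H' as [s2 z' Hz' E1 E2|s2 N E1 E2]; last by rewrite allS in N.
  by rewrite (inj _ _ E1) in Hz'; rewrite (composite_arrow_fun Hz Hz').
inversion H' as [s2 z' Hz' E1 E2|]; last by [].
by rewrite -E1 allS in N.
Qed.

Lemma leaf_function_eq (A : category) (S T : ashape A) (f g : leaf_function S T) :
  f =1 g -> label f =1 label g -> f = g.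
Proof.
case: f g => [f x p] [g y q] /= /ffunP E /ffunP E'.
by case: g / E q => q; case: y / E' q => q; rewrite (bool_irrelevance p q).
Qed.

Lemma linking_eq (A : category) (S T : ashape A) (f g : linking S T) :
  leaf_fun f = leaf_fun g -> f = g.
Proof.
by case: f g => [f p] [g q] /= E; case: g / E q => q; rewrite (proof_irrelevance _ p q).
Qed.

Lemma is_composite_uniq (A : category) (S T U : ashape A)
    (f : linking S T) (g : linking T U) (h h' : linking S U) :
  is_composite f g h -> is_composite f g h' -> h = h'.
Proof.
move=> [H1 H2] [H1' H2'].
have E : h =1 h' by move=> l; apply/esym/(H1' l _)/(H1 l _).
apply/linking_eq/leaf_function_eq => // l.
have [s p] := (H1 l _).1 erefl.
by apply: composite_label_fun (H2 l s p) _; apply: H2'; rewrite -E.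
Qed.

(* Main.v *)
(** A switching is a tree iff it is connected with one edge less than vertices,
    and connectedness is tested against predicates constant along edges. Joining
    the switchings of [f] and [g] at the roots of their copies of [T] gives trees
    for all choices in [T]; descending through [T] replaces the cut by a chain of
    identifications of the two copies (cut elimination without rewriting nets).
    In the resulting tree every vertex of [T] has a distinguished outgoing edge,
    the orbit of this map cannot be trapped in [T], and contracting along it
    yields the switching of [f;g].

    If [f] and [f'] differ by one edge from [x0], the composites differ in all the
    edges whose path visits [x0]. These edges can be rerouted one at a time: the two
    targets are connected in the common part of the two graphs, so every mixture
    of [f;g] and [f';g] is again a linking. *)

From Stdlib Require Import Relations.
From mathcomp Require Import all_boot zify.
Require Import Defs.

Set Implicit Arguments.
Unset Strict Implicit.
Unset Printing Implicit Defensive.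

(** * Trees as edge lists *)

Section EdgeLists.
Variable V : finType.
Implicit Types (E : seq (V * V)) (P : pred V).

Definition flat P E := all (fun e => P e.1 == P e.2) E.

Definition conn E := forall P, flat P E -> forall x y, P x = P y.

(** Edges are counted with multiplicity; together with connectedness this count excludes loops,
    repeated edges and the empty graph. *)
Definition tree E := conn E /\ (size E).+1 = #|V|.

(** Each edge merges at most two classes, so some labelling constant along edges takes at least
    [#|V| - size E] values; connectedness leaves it only one. *)
Lemma conn_card E : conn E -> #|V| <= (size E).+1.
Proof.
have [lab hl hc] : exists2 lab : V -> V, {in E, forall e, lab e.1 = lab e.2} &
    #|V| <= #|codom lab| + size E.
  elim: E => [|[a b] E [lab hl hc]].
    by exists id => //; rewrite addn0 card_codom.
  (* The new edge merges the class of [a] into that of [b]. *)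
  pose lab' x := if lab x == lab a then lab b else lab x.
  exists lab' => [e|].
    rewrite inE => /predU1P[->|/hl E1]; last by rewrite /lab' E1.
    by rewrite /lab' /= eqxx if_same.
  rewrite addnS -addSn; apply: leq_trans hc _; rewrite leq_add2r.
  apply: leq_trans (_ : #|predU1 (lab a) (mem (codom lab'))| <= _); last first.
    by rewrite cardU1; case: (_ \notin _).
  apply: subset_leq_card; apply/subsetP => _ /codomP[x ->].
  rewrite !inE; case: eqP => //= N; apply/codomP; exists x.
  by rewrite /lab'; case: eqP.
move=> cE; apply: leq_trans hc _; rewrite -addn1 addnC leq_add2l.
case: (pickP V) => [x0 _|V0]; last first.
  by rewrite (eq_card0 (A := mem (codom lab))) // => y; have := V0 y.
rewrite -(card1 (lab x0)); apply: subset_leq_card.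
apply/subsetP => _ /codomP[y ->]; rewrite inE.
rewrite (cE (fun y => lab y == lab x0) _ y x0) ?eqxx //.
by apply/allP => e /hl ->.
Qed.

Lemma tree_le E : conn E -> (size E).+1 <= #|V| -> tree E.
Proof. by move=> c l; split=> //; apply/eqP; rewrite eqn_leq l conn_card. Qed.

(** Without one edge of a tree too few remain for connectedness, so [b] becomes unreachable from
    [a]; [P] is the complement of the component of [a]. *)
Lemma tree_cut a b E : tree ((a, b) :: E) ->
  exists P, [/\ flat P E, ~~ P a & P b].
Proof.
move=> [cE /= sE].
pose e x y := ((x, y) \in E) || ((y, x) \in E).
have se : connect_sym e.
  by apply: sym_connect_sym => x y; rewrite /e orbC.
exists (fun x => ~~ connect e a x); rewrite negbK connect0; split=> //.
  apply/allP => -[x y] xyE /=; apply/eqP; congr (~~ _).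
  by apply: same_connect_r => //; apply: connect1; rewrite /e xyE.
apply/negP => ab; suff /conn_card : conn E by rewrite -sE ltnn.
move=> P fP; apply: cE; rewrite /flat /= -/(flat P E) fP andbT.
have cl : closed e P.
  move=> x y /orP[|] /(allP fP) /eqP //.
by apply/eqP; exact: closed_connect cl _ _ ab.
Qed.

Definition adj E x y := ((x, y) \in E) || ((y, x) \in E).

(** Counterpart of [conn_card]: without cycles each edge joins two distinct classes. The first two
    hypotheses exclude loops and parallel edges, which the bound on [ucycle] admits. *)
Lemma acyclic_codom E : uniq E ->
    (forall x y, (x, y) \in E -> (y, x) \notin E) ->
    (forall c, ucycle (adj E) c -> size c < 3) ->
  exists2 lab : V -> V,
    (forall x y, lab x = lab y -> connect (adj E) x y) &
    #|codom lab| + size E <= #|V|.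
Proof.
elim: E => [|[a b] E IH] /= uE aE acE.
  by exists id => [x y -> //|]; rewrite addn0 max_card.
have sub : subrel (adj E) (adj ((a, b) :: E)).
  by move=> x y /orP[h|h]; rewrite /adj !inE h ?orbT.
have eab : adj ((a, b) :: E) a b by rewrite /adj mem_head.
have eba : adj ((a, b) :: E) b a by rewrite /adj mem_head orbT.
have subc x y : connect (adj E) x y -> connect (adj ((a, b) :: E)) x y.
  by apply: connect_sub => u v /sub /connect1.
have [nabE uE'] := andP uE.
have [||lab hl hc] := IH uE'.
- by move=> x y xy; have := aE x y; rewrite !inE xy orbT negb_or => /(_ isT) /andP[].
- move=> c /andP[cc uc]; apply: acE; rewrite /ucycle uc andbT.
  exact: sub_cycle sub _ cc.
(* Closed by the new edge, a simple path of [E] from [a] to [b] is a cycle, so it has at most two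
   vertices; then the new edge is a loop, a repeated edge or a reversed one. *)
have nab : lab a != lab b.
  apply/eqP => /hl /connectP[p0 p0p]; case/shortenP: p0p => p pp up _ lp.
  have : size (a :: p) < 3.
    apply: acE; rewrite /ucycle up andbT /= rcons_path (sub_path sub pp).
    by rewrite -lp.
  case: p pp up lp => [|c [|//]] /=.
    move=> _ _ ab _; subst b; have := aE a a; rewrite mem_head => /(_ isT) //.
  rewrite andbT => + _ bc _; subst c; rewrite /adj (negbTE nabE) /= => ba.
  by have := aE a b; rewrite !inE eqxx ba orbT => /(_ isT).
exists (fun x => if lab x == lab a then lab b else lab x) => [x y|].
  case: eqP => xa; case: eqP => ya h.
  - by apply: subc; apply: hl; rewrite xa ya.
  - apply: connect_trans (subc _ _ (hl _ _ xa)) _.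
    by apply: connect_trans (connect1 eab) (subc _ _ (hl _ _ h)).
  - apply: connect_trans (subc _ _ (hl _ _ h)) _.
    by apply: connect_trans (connect1 eba) (subc _ _ (hl _ _ (esym ya))).
  - exact/subc/hl.
rewrite addnS -addSn; apply: leq_trans hc; rewrite leq_add2r.
rewrite (cardD1 (lab a) (mem (codom lab))) [_ \in _]codom_f add1n ltnS.
apply: subset_leq_card; apply/subsetP => _ /codomP[x ->]; rewrite !inE.
case: (lab x =P lab a) => [_|/eqP ->]; last exact: codom_f.
by rewrite eq_sym nab; apply: codom_f.
Qed.

Lemma conn_connect E x y : conn E -> connect (adj E) x y.
Proof.
move=> cE.
have sE : connect_sym (adj E).
  by apply: sym_connect_sym => u v; rewrite /adj orbC.
rewrite (cE (connect (adj E) x) _ y x) //; apply/allP => -[u v] uv /=; apply/eqP.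
by apply: same_connect_r => //; apply: connect1; rewrite /adj uv.
Qed.

(** Deleting an edge of a cycle keeps the graph connected, with fewer edges than [conn_card]
    allows. *)
Lemma tree_ucycle E c : tree E -> ucycle (adj E) c -> size c < 3.
Proof.
move=> [cE sE]; case: c => [|x [|y [|z p]]] //= /andP[/= /andP[exy]].
set q := z :: p => pq uq.
(* [adj] hides the orientation of the edge, so both are removed. *)
pose r := fun e => (e != (x, y)) && (e != (y, x)); pose E' := filter r E.
suff /conn_card : conn E'.
  rewrite -sE ltnS size_filter => h.
  have : count (predC r) E > 0.
    rewrite -has_count; apply/hasP; case/orP: exy => xy.
      by exists (x, y); rewrite //= /r eqxx.
    by exists (y, x); rewrite //= /r eqxx andbF.
  by move: h; rewrite -(count_predC r E) -[X in _ <= X]addn0 leq_add2l leqn0 => /eqP ->.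
move=> P fP; apply: cE.
have Pxy : P x = P y.
  have : path (fun u v => P u == P v) y (rcons q x).
    have xq : x \notin y :: q by case/andP: uq.
    have yq : y \notin q by case/and3P: uq.
    have step u v : adj E u v ->
        ~~ ((u == x) && (v == y)) -> ~~ ((u == y) && (v == x)) -> P u == P v.
      move=> uv n1 n2; case/orP: uv => uvE.
        have /(allP fP) // : (u, v) \in E'.
        by rewrite mem_filter uvE andbT /r !xpair_eqE n1 n2.
      rewrite eq_sym; have /(allP fP) // : (v, u) \in E'.
      by rewrite mem_filter uvE andbT /r !xpair_eqE ![(v == _) && _]andbC n1 n2.
    (* The walk misses the deleted edge: [y] can only be its first vertex, and then the second one
       is not [x]. *)
    have gen u s : path (adj E) u (rcons s x) -> x \notin u :: s -> y \notin s ->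
        (u == y -> s != [::]) -> path (fun u v => P u == P v) u (rcons s x).
      elim: s u => [|v s IHs] u /=.
        rewrite !andbT !inE => uv xu _ uy; apply: step => //.
          by rewrite eq_sym (negbTE xu).
        by rewrite eqxx andbT; apply/negP => /uy.
      move=> /andP[uv pr] + + _; rewrite !inE !negb_or => /and3P[xu xv xr] /andP[yv yr].
      rewrite step //; last by rewrite (eq_sym v) (negbTE xv) andbF.
        apply: IHs => //; last by rewrite eq_sym (negbTE yv).
        by rewrite inE negb_or xv.
      by rewrite (eq_sym u) (negbTE xu).
    exact: gen.
  have tr : transitive (fun u v => P u == P v) by move=> ? ? ? /eqP -> .
  move=> /(order_path_min tr) /allP /(_ x).
  by rewrite mem_rcons mem_head => /(_ isT) /eqP.
apply/allP => e eE; case: (boolP (e \in E')) => [/(allP fP) //|].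
rewrite mem_filter eE andbT negb_and !negbK => /orP[] /eqP -> /=; by rewrite Pxy.
Qed.

(** [adj] forgets multiplicities, hence the two conditions on [E]; [x0] makes [V] nonempty, as
    [tree] demands. *)
Lemma is_treeP (x0 : V) E e : e =2 adj E -> uniq E ->
    (forall x y, (x, y) \in E -> (y, x) \notin E) ->
  is_tree e <-> tree E.
Proof.
move=> ee uE aE; split=> [[cE acE]|tE].
  have acE' c : ucycle (adj E) c -> size c < 3.
    by rewrite /ucycle -(eq_cycle ee); apply: acE.
  apply: tree_le => [P fP x y|].
    have cl : closed (adj E) P by move=> u v /orP[|] /(allP fP) /eqP.
    by apply: (closed_connect cl); rewrite -(eq_connect ee).
  have [lab _ hc] := acyclic_codom uE aE acE'.
  apply: leq_trans hc; rewrite -add1n leq_add2r.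
  by apply/card_gt0P; exists (lab x0); apply: codom_f.
split=> [x y|c]; first by rewrite (eq_connect ee); apply: conn_connect tE.1.
by rewrite /ucycle (eq_cycle ee); apply: tree_ucycle.
Qed.

End EdgeLists.

Definition emap (V W : Type) (f : V -> W) (E : seq (V * V)) : seq (W * W) :=
  [seq (f e.1, f e.2) | e <- E].

Lemma flat_map (V W : finType) (f : V -> W) (P : pred W) E :
  flat P (emap f E) = flat (P \o f) E.
Proof. by rewrite /flat /emap all_map. Qed.

Lemma flat_cat (V : finType) (P : pred V) E E' :
  flat P (E ++ E') = flat P E && flat P E'.
Proof. exact: all_cat. Qed.

Lemma flat_cons (V : finType) (P : pred V) e E :
  flat P (e :: E) = (P e.1 == P e.2) && flat P E.
Proof. by []. Qed.

(** Reduces a rearrangement of edges to deriving the old equations from the new ones, plus a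
    count. *)
Lemma tree_change (V : finType) (E E' : seq (V * V)) :
  tree E -> (forall P, flat P E' -> flat P E) -> size E' = size E -> tree E'.
Proof.
move=> [cE sE] h eqs; split; last by rewrite eqs.
by move=> P /h; apply: cE.
Qed.

Lemma tree_union (V W : finType) (E : seq (V * V)) (E' : seq (W * W)) a b :
  tree E -> tree E' ->
  tree ((inl a, inr b) :: emap (@inl V W) E ++ emap (@inr V W) E').
Proof.
move=> [cE sE] [cE' sE']; split; last first.
  by rewrite /= size_cat !size_map card_sum -sE -sE' addSn addnS.
move=> P; rewrite flat_cons flat_cat !flat_map => /and3P[/eqP /= eab /cE h /cE' h'].
have l x : P (inl x) = P (inl a) by apply: (h x a).
have r x : P (inr x) = P (inl a) by rewrite eab; apply: (h' x b).
by case=> x [] y; rewrite ?l ?r.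
Qed.

(** By the cardinality hypothesis each contracted edge of [E1] costs exactly one vertex; [r] lifts
    the vertices of [V] back to [W]. *)
Lemma tree_contract (V W : finType) (q : W -> V) (r : V -> W) E1 E2 :
    cancel r q -> {in E1, forall e, q e.1 = q e.2} ->
    #|W| = #|V| + size E1 ->
  tree (E1 ++ E2) -> tree (emap q E2).
Proof.
move=> rK hq eqc [cE sE]; split; last first.
  by apply/eqP; rewrite size_map -(eqn_add2r (size E1)) -eqc -sE size_cat addSn addnC.
move=> P; rewrite flat_map => h x y.
rewrite -[x]rK -[y]rK; apply: (cE (P \o q)); rewrite flat_cat h andbT.
by apply/allP => e /hq /= ->.
Qed.

(** Cut elimination at a tensor: [v] keeps both arguments, [w] is switched, and cuts between
    corresponding arguments are created while [v] and [w] stay attached. *)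
Lemma tree_tensor_step (V : finType) (v w a1 a2 b1 b2 : V) (B : seq (V * V)) :
    tree [:: (v, a1), (v, a2), (v, w), (w, b1) & B] ->
    tree [:: (v, a1), (v, a2), (v, w), (w, b2) & B] ->
  tree [:: (v, a1), (v, w), (a1, b1), (a2, b2) & B].
Proof.
move=> H1 H2; split; last by case: H1.
move=> P; rewrite !flat_cons /= => /and5P[/eqP va /eqP vw /eqP ab1 /eqP ab2 fB].
have [va2|nva2] := eqVneq (P v) (P a2).
  by apply: H1.1; rewrite !flat_cons /= -va -vw -ab1 -va va2 !eqxx.
have /tree_cut[X [fX nX Xb]] :
    tree ((w, b1) :: [:: (v, a1), (v, a2), (v, w) & B]).
  by apply: tree_change H1 _ _ => // Q; rewrite !flat_cons => /and5P[-> -> -> -> ->].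
move: fX; rewrite !flat_cons /= => /and4P[/eqP Xva /eqP Xva2 /eqP Xvw fX].
have Xv : X v = false by rewrite Xvw (negbTE nX).
(* [X] is the side of [b1] once its edge to [w] is cut in the first tree. [Q] would separate [b1]
   from [v] in the second tree, being false at [b2] since [P b2 = P a2] differs from [P v]. *)
pose Q := [pred x | X x && (P x == P v)].
have: Q b1 = Q v.
  apply: H2.1; rewrite !flat_cons /= -Xva -Xva2 -Xvw Xv /=.
  rewrite -ab2 eq_sym [P a2 == _]eq_sym (negbTE nva2) andbF /=.
  by apply/allP => e eB /=; rewrite (eqP (allP fX _ eB)) (eqP (allP fB _ eB)).
by rewrite /Q /= Xb -ab1 -va eqxx Xv.
Qed.

(** * Parse trees and the cut shape *)

(* The argument edges that survive when the tensors of sign [p] are switched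
   according to [d]. *)
Fixpoint arcs (A : category) (S : ashape A) (p : bool) :
    (vertex S -> bool) -> seq (vertex S * vertex S) :=
  match S with
  | Atom _ => fun _ => [::]
  | Tensor S1 S2 => fun d =>
      let l := (None, Some (inl (root S1))) in
      let r := (None, Some (inr (root S2))) in
      (if p then [:: if d None then l else r] else [:: l; r])
      ++ emap (Some \o inl) (arcs p (d \o Some \o inl))
      ++ emap (Some \o inr) (arcs p (d \o Some \o inr))
  | Dual S1 => fun d =>
      (None, Some (root S1)) :: emap Some (arcs (~~ p) (d \o Some))
  end.

Fixpoint inner (A : category) (S : ashape A) : seq (vertex S) :=
  match S with
  | Atom _ => [::]
  | Tensor S1 S2 => None :: map (Some \o inl) (inner S1) ++ map (Some \o inr) (inner S2)
  | Dual S1 => None :: map Some (inner S1)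
  end.

(** Supplies each inner vertex with one outgoing edge, leading towards a leaf; leaves get themselves
    as a filler. *)
Fixpoint child (A : category) (S : ashape A) : vertex S -> vertex S :=
  match S with
  | Atom _ => id
  | Tensor S1 S2 => fun v =>
      match v with
      | None => Some (inl (root S1))
      | Some (inl v1) => Some (inl (child v1))
      | Some (inr v2) => Some (inr (child v2))
      end
  | Dual S1 => fun v =>
      if v is Some v1 then Some (child v1) else Some (root S1)
  end.

(** Listed by recursion rather than by [enum], so that the list unfolds along the induction on the
    shape. *)
Fixpoint vertices (A : category) (S : ashape A) : seq (vertex S) :=
  match S with
  | Atom _ => [:: tt]
  | Tensor S1 S2 => None :: map (Some \o inl) (vertices S1) ++ map (Some \o inr) (vertices S2)
  | Dual S1 => None :: map Some (vertices S1)
  end.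

Lemma mem_emap (V W : eqType) (f : V -> W) (E : seq (V * V)) v w : injective f ->
  ((f v, f w) \in emap f E) = ((v, w) \in E).
Proof.
move=> fI; rewrite (mem_map (f := fun e => (f e.1, f e.2)) _ E (v, w)) //.
by move=> [? ?] [? ?] /= [/fI -> /fI ->].
Qed.

Lemma emap_out (V W : eqType) (f : V -> W) (E : seq (V * V)) x y :
  (forall v, f v != x) \/ (forall v, f v != y) -> ((x, y) \in emap f E) = false.
Proof.
by move=> h; apply/negP => /mapP[[v w] _ [xv yw]]; case: h => h;
  [have := h v | have := h w]; rewrite (xv, yw) eqxx.
Qed.

Lemma Some_inl_inj (V W : Type) : injective (Some \o @inl V W).
Proof. by move=> ? ? []. Qed.

Lemma Some_inr_inj (V W : Type) : injective (Some \o @inr V W).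
Proof. by move=> ? ? []. Qed.

(** A dual negates both [p] and the sign of each vertex below it, so the test [positive v == p] is
    stable under the recursion. *)
Lemma mem_arcs (A : category) (S : ashape A) p d (v w : vertex S) :
  ((v, w) \in arcs p d) =
  [exists b, arg b v w && ~~ (is_tensor (symbol_at v) && (positive v == p) && (d v == b))].
Proof.
elim: S p d v w => [x|S1 IH1 S2 IH2|S1 IH1] p d v w.
- by symmetry; apply/existsP => -[].
- have none (P : pred bool) : P =1 xpred0 -> [exists b, P b] = false.
    by move=> P0; apply/existsP => -[b]; rewrite P0.
  rewrite /= mem_cat mem_cat.
  have hd v' w' : (Some v', w') \notin (if p then
      [:: if d None then (None, Some (inl (root S1))) else (None, Some (inr (root S2)))]
      else [:: (None, Some (inl (root S1))); (None, Some (inr (root S2)))]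
      : seq (vertex (Tensor S1 S2) * vertex (Tensor S1 S2))).
    by case: p; case: (d None).
  have mi E x y := @mem_emap _ _ _ E x y (@Some_inl_inj (vertex S1) (vertex S2)).
  have mr E x y := @mem_emap _ _ _ E x y (@Some_inr_inj (vertex S1) (vertex S2)).
  case: v => [[v|v]|]; first (rewrite (negbTE (hd _ _)); case: w => [[w|w]|]).
  + by rewrite mi IH1 emap_out ?orbF //; left.
  + by rewrite none ?[_ \in emap _ _]emap_out //; [left|right].
  + by rewrite none ?[_ \in emap _ _]emap_out //; right.
  + rewrite (negbTE (hd _ _)); case: w => [[w|w]|].
    * by rewrite none ?[_ \in emap _ _]emap_out //; [right|left].
    * by rewrite mr IH2 emap_out //; left.
    * by rewrite none ?[_ \in emap _ _]emap_out //; right.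
  + rewrite ![_ \in emap _ _]emap_out ?orbF; try by left.
    clear hd mi mr.
    case: w => [[w|w]|].
    * apply/idP/existsP => [h|[[] //=]].
        by exists false; move: h; case: p; case: (d None); rewrite ?inE //= ?orbF;
          move=> /eqP[->]; rewrite eqxx.
      by case: p; case: (d None); rewrite ?inE ?andbT ?andbF //= => /eqP ->; rewrite eqxx.
    * apply/idP/existsP => [h|[[] //=]].
        by exists true; move: h; case: p; case: (d None); rewrite ?inE //= ?orbF;
          move=> /eqP[->]; rewrite eqxx.
      by case: p; case: (d None); rewrite ?inE ?andbT ?andbF //= => /eqP ->; rewrite eqxx ?orbT.
    * by rewrite none //; case: p; case: (d None).
- rewrite /= inE; case: v => [v|]; case: w => [w|].
  + rewrite mem_emap; last exact: Some_inj.
    rewrite IH1; apply: eq_existsb => b.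
    by case: (positive v); case: p.
  + by rewrite emap_out; [symmetry; apply/existsP => -[] | right].
  + rewrite emap_out ?orbF; last by left.
    apply/eqP/existsP => [[->]|]; first by exists false; rewrite eqxx.
    by move=> [[] //=]; rewrite andbT => /eqP ->.
  + by rewrite emap_out; [symmetry; apply/existsP => -[] | right].
Qed.

Lemma uniq_emap (V W : eqType) (f : V -> W) (E : seq (V * V)) :
  injective f -> uniq (emap f E) = uniq E.
Proof. by move=> fI; apply: map_inj_uniq => -[? ?] [? ?] /= [/fI -> /fI ->]. Qed.

Lemma arcs_uniq (A : category) (S : ashape A) p d : uniq (@arcs A S p d).
Proof.
elim: S p d => [x|S1 IH1 S2 IH2|S1 IH1] p d //=; last first.
  rewrite uniq_emap ?IH1 ?andbT; last exact: Some_inj.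
  by rewrite emap_out //; left.
rewrite !cat_uniq !uniq_emap ?IH1 ?IH2; try by [exact: Some_inl_inj|exact: Some_inr_inj].
rewrite andbT; apply/and3P; split.
- by case: p; case: (d None).
- apply/hasPn => -[x y]; rewrite mem_cat => /orP[] /mapP[[? ?] _ [-> ->]];
  by case: p; case: (d None).
- apply/hasPn => -[x y] /mapP[[? ?] _ [-> ->]] /=.
  by rewrite emap_out //; left.
Qed.

Lemma arg_asym (A : category) (S : ashape A) b b' (v w : vertex S) :
  arg b v w -> ~~ arg b' w v.
Proof.
elim: S b b' v w => [x|S1 IH1 S2 IH2|S1 IH1] b b' //=.
  by case=> [[v|v]|] [[w|w]|] //=; [apply: IH1|apply: IH2].
by case=> [v|] [w|] //=; apply: IH1.
Qed.

Lemma arg_leaf (A : category) (S : ashape A) b (v w : vertex S) :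
  arg b v w -> ~~ is_leaf (symbol_at v).
Proof.
elim: S b v w => [x|S1 IH1 S2 IH2|S1 IH1] b //=.
  by case=> [[v|v]|] [[w|w]|] //=; [apply: IH1|apply: IH2].
by case=> [v|] [w|] //=; apply: IH1.
Qed.

(** * Switchings as edge lists *)

Definition leaf_edges (A : category) (S T : ashape A) (f : src S T -> tgt S T) :
    seq (vertex2 S T * vertex2 S T) :=
  [seq (val l, val (f l)) | l <- enum (src S T)].

Definition arcs2 (A : category) (S T : ashape A) (d : vertex2 S T -> bool) :
    seq (vertex2 S T * vertex2 S T) :=
  emap inl (arcs true (d \o inl)) ++ emap inr (arcs false (d \o inr)).

Lemma mem_arcs2 (A : category) (S T : ashape A) d (v w : vertex2 S T) :
  ((v, w) \in arcs2 d) =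
  [exists b, arg2 b v w && ~~ (switched_tensor v && (d v == b))].
Proof.
rewrite /arcs2 mem_cat /switched_tensor /=.
have li : injective (@inl (vertex S) (vertex T)) by move=> ? ? [].
have ri : injective (@inr (vertex S) (vertex T)) by move=> ? ? [].
have none (P : pred bool) : P =1 xpred0 -> [exists b, P b] = false.
  by move=> P0; apply/existsP => -[b]; rewrite P0.
case: v w => v [] w.
- rewrite mem_emap // mem_arcs emap_out ?orbF; last by left.
  by apply: eq_existsb => b /=; rewrite eqb_id.
- by rewrite none // !emap_out //; [left|right].
- by rewrite none // !emap_out //; [right|left].
- rewrite orbC mem_emap // mem_arcs emap_out ?orbF; last by left.
  by apply: eq_existsb => b /=; rewrite eqbF_neg.
Qed.

Lemma mem_leaf_edges (A : category) (S T : ashape A) (f : src S T -> tgt S T) v w :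
  ((v, w) \in leaf_edges f) = [exists l, (val l == v) && (val (f l) == w)].
Proof.
apply/mapP/existsP => [[l _ [-> ->]]|[l /andP[/eqP <- /eqP <-]]]; exists l => //.
  by rewrite !eqxx.
by rewrite mem_enum.
Qed.

Lemma arcs2_uniq (A : category) (S T : ashape A) (d : vertex2 S T -> bool) :
  uniq (arcs2 d).
Proof.
rewrite cat_uniq !uniq_emap ?arcs_uniq ?andbT /=; try by move=> ? ? [].
by apply/hasPn => -[x y] /mapP[[? ?] _ [-> ->]]; rewrite /= emap_out //; left.
Qed.

Lemma leaf_edges_uniq (A : category) (S T : ashape A) (f : src S T -> tgt S T) :
  uniq (leaf_edges f).
Proof. by rewrite map_inj_uniq ?enum_uniq // => l l' [/val_inj]. Qed.

Lemma arg2_leaf (A : category) (S T : ashape A) b (v w : vertex2 S T) :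
  arg2 b v w -> ~~ is_leaf (symbol2 v).
Proof. by case: v w => v [] w //=; apply: arg_leaf. Qed.

Lemma arg2_asym (A : category) (S T : ashape A) b b' (v w : vertex2 S T) :
  arg2 b v w -> ~~ arg2 b' w v.
Proof. by case: v w => v [] w //=; apply: arg_asym. Qed.

(** [is_treeP] applies: argument edges start at inner vertices, while leaf edges join leaves and run
    from sources to targets, so no edge is repeated or reversed. *)
Lemma switching_treeP (A : category) (S T : ashape A) (f : leaf_function S T) d :
  is_tree (switching f d) <-> tree (arcs2 d ++ leaf_edges f).
Proof.
have mE v w : switching_arc f d v w = ((v, w) \in arcs2 d ++ leaf_edges f).
  by rewrite mem_cat mem_arcs2 mem_leaf_edges.
have leafE v w : (v, w) \in leaf_edges f -> is_leaf (symbol2 v) && is_leaf (symbol2 w).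
  by move=> /mapP[l _ [-> ->]]; case/andP: (valP l) => -> _; case/andP: (valP (f l)).
have nleafE v w : (v, w) \in arcs2 d -> ~~ is_leaf (symbol2 v).
  by rewrite mem_arcs2 => /existsP[b /andP[/arg2_leaf]].
apply: (is_treeP (inl (root S))).
- by move=> v w; rewrite /switching /adj !mE.
- rewrite cat_uniq arcs2_uniq leaf_edges_uniq andbT /=; apply/hasPn => -[v w].
  by move=> /leafE /andP[+ _]; apply: contraL => /nleafE.
- move=> v w; rewrite [_ \in arcs2 d ++ _]mem_cat [(w, v) \in arcs2 d ++ _]mem_cat.
  rewrite negb_or => /orP[] vw; apply/andP; split.
  + move: vw; rewrite !mem_arcs2 => /existsP[b /andP[ab _]].
    by apply/existsP => -[b' /andP[]]; rewrite (negbTE (arg2_asym _ ab)).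
  + by apply: contra (nleafE _ _ vw) => /leafE /andP[].
  + by apply: contraL vw => /nleafE; apply: contra => /leafE /andP[].
  + apply/negP; case/mapP: vw => l _ [-> ->] /mapP[l' _ []] e _.
    have {}e : sign2 (val (f l)) = sign2 (val l') by congr sign2.
    have /andP[_] := valP (f l); rewrite e.
    by have /andP[_ ->] := valP l'.
Qed.

Lemma emap_comp (U V W : Type) (f : V -> W) (g : U -> V) E :
  emap f (emap g E) = emap (f \o g) E.
Proof. by rewrite /emap -map_comp. Qed.

Lemma emap_cat (V W : Type) (f : V -> W) E E' :
  emap f (E ++ E') = emap f E ++ emap f E'.
Proof. exact: map_cat. Qed.

Ltac size_norm :=
  repeat match goal with X := _ : seq _ |- _ => progress unfold X end;
  rewrite /emap; repeat (progress (rewrite ?(size_cat, size_map) /=)).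

Ltac size_solve :=
  size_norm; repeat match goal with |- context [size ?l] =>
    let n := fresh "n" in set n := (size l); move: n => n end; lia.

Ltac flat_solve :=
  repeat match goal with X := _ : seq _ |- _ => progress unfold X end;
  rewrite /flat; repeat (progress (rewrite /emap ?(all_cat, all_map) /=));
  repeat first [case/andP | move=> ?]; repeat (apply/andP; split); try done;
  repeat match goal with H : is_true (_ == _) |- _ => move/eqP: H => H end;
  apply/eqP; first [congruence | match goal with
    a : _ = _, b : _ = _, c : _ = _ |- _ => by rewrite -a b c end].

(* The two copies of the cut shape [T] are joined along [i] and [j]; one of
   them switches the positive tensors and the other one the negative tensors.
   Each edge [i v -- i (child v)] keeps the identified inner vertex [v] in the tree. *)
Lemma tree_cut_shape (A : category) (T : ashape A) (W : finType) (p : bool)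
    (i j : vertex T -> W) (B : seq (W * W)) :
  (forall d d', tree ((i (root T), j (root T)) ::
     emap i (arcs p d) ++ emap j (arcs (~~ p) d') ++ B)) ->
  tree ([seq (i v, j v) | v <- vertices T] ++ [seq (i v, i (child v)) | v <- inner T] ++ B).
Proof.
elim: T W p i j B => [x|T1 IH1 T2 IH2|T1 IH1] W p i j B H.
- exact: H (fun=> true) (fun=> true).
- pose i1 := i \o Some \o inl; pose j1 := j \o Some \o inl.
  pose i2 := i \o Some \o inr; pose j2 := j \o Some \o inr.
  pose C := [:: (i None, i1 (root T1)), (i None, j None) & B].
  (* The cut at the tensor is split into cuts at both arguments, for independent switchings of all
     subtrees. *)
  have step d1 d1' d2 d2' : tree ((i1 (root T1), j1 (root T1)) ::
      emap i1 (arcs p d1) ++ emap j1 (arcs (~~ p) d1') ++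
      (i2 (root T2), j2 (root T2)) ::
      emap i2 (arcs p d2) ++ emap j2 (arcs (~~ p) d2') ++ C).
    pose dd c (d1 : vertex T1 -> bool) (d2 : vertex T2 -> bool) :=
      fun v : vertex (Tensor T1 T2) =>
        match v with None => c | Some (inl x) => d1 x | Some (inr x) => d2 x end.
    have e1 c d e : (dd c d e \o Some) \o inl = d by [].
    have e2 c d e : (dd c d e \o Some) \o inr = e by [].
    pose B0 := emap i1 (arcs p d1) ++ emap i2 (arcs p d2) ++
      emap j1 (arcs (~~ p) d1') ++ emap j2 (arcs (~~ p) d2') ++ B.
    have Hc c := H (dd c d1 d2) (dd c d1' d2').
    have sub : tree [:: (i None, i1 (root T1)), (i None, j None),
        (i1 (root T1), j1 (root T1)), (i2 (root T2), j2 (root T2)) & B0].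
      (* The switched copy is [i] if [p] holds and [j] otherwise. Its two settings at the tensor,
         [true] keeping the left argument, supply the two trees of [tree_tensor_step]. *)
      case: (p) @B0 Hc => B0 Hc.
        have st : tree [:: (j None, j1 (root T1)), (j None, i None),
            (j1 (root T1), i1 (root T1)), (j2 (root T2), i2 (root T2)) & B0].
          apply: tree_tensor_step.
            by apply: tree_change (Hc true) _ _ => [P|]; [flat_solve|size_norm; rewrite !(addSn, addnS) -!addnA].
          by apply: tree_change (Hc false) _ _ => [P|]; [flat_solve|size_norm; rewrite !(addSn, addnS) -!addnA].
        by apply: tree_change st _ _ => [P|]; [flat_solve|size_solve].
      have st : tree [:: (i None, i1 (root T1)), (i None, j None),
          (i1 (root T1), j1 (root T1)), (i2 (root T2), j2 (root T2)) & B0].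
        apply: tree_tensor_step.
          by apply: tree_change (Hc true) _ _ => [P|]; [flat_solve|size_norm; rewrite !(addSn, addnS) -!addnA].
        by apply: tree_change (Hc false) _ _ => [P|]; [flat_solve|size_norm; rewrite !(addSn, addnS) -!addnA].
      by apply: tree_change st _ _ => [P|]; [flat_solve|size_solve].
    by apply: tree_change sub _ _ => [P|]; [flat_solve|size_solve].
  (* The cut at [T1] is eliminated while that at [T2] sits in the surrounding list, then the cut at
     [T2]; this is why [B] is arbitrary. *)
  pose D := [seq (i1 v, j1 v) | v <- vertices T1] ++ [seq (i1 v, i1 (child v)) | v <- inner T1] ++ C.
  have sub : tree ([seq (i2 v, j2 v) | v <- vertices T2] ++
       [seq (i2 v, i2 (child v)) | v <- inner T2] ++ D).
    apply: (IH2 _ p) => d2 d2'.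
    pose E := (i2 (root T2), j2 (root T2)) ::
       emap i2 (arcs p d2) ++ emap j2 (arcs (~~ p) d2') ++ C.
    have sub1 : tree ([seq (i1 v, j1 v) | v <- vertices T1] ++
       [seq (i1 v, i1 (child v)) | v <- inner T1] ++ E).
      by apply: (IH1 _ p) => d1 d1'; apply: step.
    by apply: tree_change sub1 _ _ => [P|]; [flat_solve|size_solve].
  by apply: tree_change sub _ _ => [P|]; [flat_solve|size_solve].
- pose i1 := i \o Some; pose j1 := j \o Some.
  pose C := [:: (i None, i1 (root T1)), (i None, j None) & B].
  have sub : tree ([seq (i1 v, j1 v) | v <- vertices T1] ++
       [seq (i1 v, i1 (child v)) | v <- inner T1] ++ C).
    (* The dual flips the sign on both copies. Only tensors are switched, so the switchings are
       extended to the dual by the filler [true]. *)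
    apply: (IH1 _ (~~ p)) => d d'.
    apply: tree_change (H (oapp d true) (oapp d' true)) _ _ => [P|]; [unfold C, i1, j1; flat_solve|size_solve].
  by apply: tree_change sub _ _ => [P|]; [flat_solve|size_solve].
Qed.

(** * Contraction along a trace *)

Section Trace.
Variables (K T : finType) (isrc : pred K).
Implicit Types (next : K + T -> K + T) (B : seq (K * K)) (q : K + T -> K).

(** [K] stands for the vertices outside the cut and [T] for the interface; an active vertex has one
    outgoing edge, given by [next]. *)
Definition active (x : K + T) := if x is inl k then isrc k else true.

Definition graph_edges next B : seq ((K + T) * (K + T)) :=
  [seq (x, next x) | x <- enum active] ++ emap inl B.

(** [q] follows [next] until [T] is left; the equations are a recursion along the orbit. *)
Definition is_exit next q :=
  (forall k, q (inl k) = k) /\ (forall t, q (inr t) = q (next (inr t))).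

Lemma flat_graph_edges next B P :
  reflect ((forall x, active x -> P x = P (next x)) /\ flat (P \o inl) B)
    (flat P (graph_edges next B)).
Proof.
rewrite flat_cat flat_map; apply: (iffP andP) => -[h ->]; split=> //.
  by move=> x ax; apply/eqP/(allP h (x, next x)); apply: map_f; rewrite mem_enum.
by apply/allP => _ /mapP[x + ->]; rewrite mem_enum => /h /eqP.
Qed.

Lemma card_active : #|active| = #|isrc| + #|T|.
Proof.
have p : perm_eq (enum active) (map inl (enum isrc) ++ map inr (enum T)).
  apply: uniq_perm; first exact: enum_uniq.
    rewrite cat_uniq !map_inj_uniq ?enum_uniq /= ?andbT; try by move=> ? ? [].
    by rewrite -enumT enum_uniq andbT; apply/hasPn => _ /mapP[t _ ->]; apply/mapP => -[].
  move=> x; rewrite mem_cat mem_enum; case: x => [k|t].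
    rewrite mem_map; last by move=> ? ? [].
    rewrite mem_enum [X in _ || X](_ : _ = false) ?orbF //.
    by apply/mapP => -[].
  by rewrite orbC map_f // mem_enum.
by rewrite [LHS]cardE (perm_size p) size_cat !size_map -!cardE -enumT -cardE.
Qed.

(** A nonempty subset of [T] closed under [next] would carry as many edges as vertices, one more
    than a tree can have. *)
Lemma no_trap next B (D : pred T) : tree (graph_edges next B) ->
  (exists t, D t) -> exists2 t, D t & ~~ (if next (inr t) is inr t' then D t' else false).
Proof.
move=> [cE sE] [t0 Dt0].
have [/forall_inP h|] := boolP [forall (t | D t),
    if next (inr t) is inr t' then D t' else false]; last first.
  by rewrite negb_forall => /existsP[t]; rewrite negb_imply => /andP[]; exists t.
pose inD (x : K + T) := if x is inr t then D t else false.
(* On a trap [D] the edges leaving it could be replaced by a star, which has one edge less. *)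
pose E := [seq (inr t0, x) | x <- enum (predD1 inD (inr t0))] ++
  [seq (x, next x) | x <- enum (predD active inD)] ++ emap inl B.
have sD : #|predD1 inD (inr t0)|.+1 = #|inD|.
  by rewrite [RHS](cardD1 (inr t0)) [_ \in _]Dt0.
have sA : #|inD| + #|predD active inD| = #|active|.
  rewrite -(cardID inD active); congr (_ + _); apply: eq_card => -[k|t];
  by rewrite !inE /= ?andbF ?andbT.
suff /conn_card : conn E.
  have -> : size E = #|predD1 inD (inr t0)| + #|predD active inD| + size B.
    by rewrite !size_cat !size_map -!cardE addnA.
  by rewrite -sE size_cat !size_map -cardE -sA -sD !addSn ltnn.
move=> P; rewrite !flat_cat flat_map => /and3P[f1 f2 f3]; apply: cE.
have PD x : inD x -> P x = P (inr t0).
  move=> Dx; have [->//|nx] := eqVneq x (inr t0).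
  apply/esym/eqP/(allP f1 (_, x)); apply: map_f.
  by rewrite mem_enum !inE nx.
apply/flat_graph_edges; split=> // x ax.
have [Dx|nDx] := boolP (inD x).
  rewrite (PD x) // (PD (next x)) //; case: x Dx {ax} => [//|t] Dt.
  by have := h t Dt; rewrite /inD; case: (next (inr t)).
by apply/eqP/(allP f2 (x, next x)); apply: map_f; rewrite mem_enum !inE nDx.
Qed.

(** Vertices of [K] become fixed points, so that orbits halt at their exits. *)
Definition stepT next (x : K + T) := if x is inr t then next (inr t) else x.

(** The vertices of [T] that never reach [K] are closed under [next], against [no_trap]. *)
Lemma trace_exit next B x : tree (graph_edges next B) ->
  exists k, fconnect (stepT next) x (inl k).
Proof.
move=> tr; case: x => [k|t]; first by exists k.
have [/existsP//|nt] := boolP [exists k, fconnect (stepT next) (inr t) (inl k)].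
pose D t := ~~ [exists k, fconnect (stepT next) (inr t) (inl k)].
have [|t' + Dn] := no_trap (D := D) tr; first by exists t.
case/existsP.
have := fconnect1 (stepT next) (inr t'); rewrite [X in fconnect _ _ X]/=.
move: Dn; case: (next (inr t')) => [k|t2]; first by exists k.
rewrite negbK => /existsP[k hk] h; exists k.
exact: connect_trans h hk.
Qed.

(** Induction on the number of steps to the exit. *)
Lemma trace_ind next B (P : K + T -> Prop) : tree (graph_edges next B) ->
  (forall k, P (inl k)) -> (forall t, P (next (inr t)) -> P (inr t)) -> forall x, P x.
Proof.
move=> tr Pl Pr x; have [k /iter_findex] := trace_exit x tr.
move: (findex _ _ _) => n; elim: n x => [|n IH] x; first by move=> /= ->.
by rewrite iterSr; case: x => // t /IH /Pr.
Qed.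

Lemma exit_exists next B : tree (graph_edges next B) -> exists q, is_exit next q.
Proof.
move=> tr; exists (fun x => xchoose (trace_exit x tr)); split=> [k|t].
  have := xchooseP (trace_exit (inl k) tr); move/iter_findex.
  by rewrite iter_fix // => -[].
(* A vertex of [T] and its successor reach the same exits, so the same witness is chosen. *)
apply: eq_xchoose => k; apply/idP/idP => [/iter_findex|].
  by move: (findex _ _ _) => [|n] //; rewrite iterSr => <-; exact: fconnect_iter.
exact/connect_trans/fconnect1.
Qed.

(** Contracts the edges leaving [T], one per vertex of [T], which joins each source directly to the
    exit of its trace. *)
Lemma tree_trace next B q h : is_exit next q ->
    (forall k, isrc k -> h k = q (next (inl k))) ->
  tree (graph_edges next B) -> tree ([seq (k, h k) | k <- enum isrc] ++ B).
Proof.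
move=> [ql qr] hE tr.
have sub : tree ([seq (inr t, next (inr t)) | t <- enum T] ++
    [seq (inl k, next (inl k)) | k <- enum isrc] ++ emap inl B).
  apply: tree_change tr _ _ => [P|]; last first.
    by rewrite !size_cat !size_map -enumT -!cardE card_active addnCA addnA.
  move=> fP; apply/flat_graph_edges; move: fP.
  rewrite !flat_cat flat_map => /and3P[/allP h1 /allP h2 h3].
  split=> // -[k|t] a; apply/eqP.
    by apply: (h2 (inl k, _)); apply: map_f; rewrite mem_enum.
  by apply: (h1 (inr t, _)); apply: map_f; rewrite mem_enum.
have := tree_contract (r := inl) ql _ _ sub; rewrite emap_cat emap_comp /=.
have -> : emap (q \o inl) B = B.
  by rewrite -[RHS]map_id; apply: eq_map => -[a b]; rewrite /= !ql.
have -> : emap q [seq (inl k, next (inl k)) | k <- enum isrc] =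
    [seq (k, h k) | k <- enum isrc].
  rewrite /emap -map_comp; apply/eq_in_map => k; rewrite mem_enum => sk /=.
  by rewrite ql hE.
apply; last by rewrite card_sum size_map -cardE.
by move=> _ /mapP[t _ ->] /=; apply: qr.
Qed.

(* Deleting the edge [x0 -- next x0] leaves two components; [next x0] and [next' x0]
   lie in the one without [x0], and a path joining them there projects to a path
   joining their exits which uses no edge of the trace graph that was rerouted. *)
Lemma tree_mixture next next' B q q' x0 h :
    is_exit next q -> is_exit next' q' -> active x0 ->
    (forall x, x != x0 -> next x = next' x) ->
    tree (graph_edges next B) -> tree (graph_edges next' B) ->
    (forall k, isrc k -> h k = q (next (inl k)) \/ h k = q' (next' (inl k))) ->
  tree ([seq (k, h k) | k <- enum isrc] ++ B).
Proof.
move=> [ql qr] [ql' qr'] ax0 nE tr tr' hE.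
have trq := tree_trace (conj ql qr) (fun k _ => erefl) tr.
split; last by rewrite -trq.2 !size_cat !size_map.
move=> P fP.
have [C [fC nC Cn]] : exists C : pred (K + T),
    [/\ (forall x, active x -> x != x0 -> C x = C (next x)) /\ flat (C \o inl) B,
     ~~ C x0 & C (next x0)].
  have : tree ((x0, next x0) :: [seq (x, next x) | x <- enum (predD1 active x0)] ++ emap inl B).
    apply: tree_change tr _ _ => [Q|]; last first.
      by rewrite /= !size_cat !size_map -!cardE [in RHS](cardD1 x0) [x0 \in _]ax0.
    move=> fQ; apply/flat_graph_edges; move: fQ.
    rewrite flat_cons flat_cat flat_map => /and3P[/eqP e0 /allP e1 e2].
    split=> // x ax; have [->//|nx] := eqVneq x x0.
    by apply/eqP/(e1 (x, next x)); apply: map_f; rewrite mem_enum !inE nx.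
  move=> /tree_cut[C [fC ? ?]]; exists C; split=> //.
  move: fC; rewrite flat_cat flat_map => /andP[/allP e1 ?]; split=> // x ax nx.
  by apply/eqP/(e1 (x, next x)); apply: map_f; rewrite mem_enum !inE nx.
case: fC => fC fCB.
(* Otherwise [C] would be flat on the second graph and still separate [x0] from [next x0]. *)
have Cn' : C (next' x0).
  apply/negPn/negP => nCn'; have := tr'.1 C _ x0 (next x0).
  rewrite Cn (negbTE nC) => H; suff: false = true by []; apply: H.
  apply/flat_graph_edges; split=> // x ax; have [->|nx] := eqVneq x x0.
    by rewrite (negbTE nC) (negbTE nCn').
  by rewrite -nE //; apply: fC.
(* A trace starting in [C] stays there until its exit and never meets [x0]. *)
have qC x : C x -> q x = q' x.
  move: x; apply: (trace_ind tr) => [k _|t IH Ct]; first by rewrite ql ql'.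
  have nt : inr t != x0 by apply: contraNneq nC => <-.
  by rewrite qr qr' -nE // IH // -fC.
pose m := q (next x0); pose m' := q' (next' x0).
(* A trace either avoids [x0], or runs through it and ends at [m] and [m'] respectively. *)
have qB x : q x = q' x \/ (q x = m /\ q' x = m').
  move: x; apply: (trace_ind tr) => [k|t IH]; first by left; rewrite ql ql'.
  have [e|nt] := eqVneq (inr t) x0; first by right; rewrite qr qr' /m /m' -e.
  by rewrite qr qr' -nE.
have {fP} [fP fPB] : (forall k, isrc k -> P k = P (h k)) /\ flat P B.
  move: fP; rewrite flat_cat => /andP[/allP fP ->]; split=> // k sk.
  by apply/eqP/(fP (k, h k)); apply: map_f; rewrite mem_enum.
have Pm : P m = P m'.
  (* If [P] separated [m] from [m'], then [R] would be flat on the first graph, yet true at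
     [next' x0] and false at [x0]. *)
  apply/eqP/negPn/negP => nPm; pose R x := C x && (P (q x) == P m').
  have : R (next' x0) = R x0.
    apply: tr.1; apply/flat_graph_edges; rewrite /R; split; last first.
      apply/allP => e eB /=; rewrite !ql.
      by have /eqP /= -> := allP fCB _ eB; have /eqP -> := allP fPB _ eB.
    move=> x ax; have [->|nx] := eqVneq x x0.
      by rewrite (negbTE nC) -/m (negbTE nPm) andbF.
    rewrite -fC //; case Cx: (C x) => //=.
    case: x ax nx Cx => [k|t] ax nx Cx; last by rewrite qr.
    have Cn2 : C (next (inl k)) by rewrite -fC.
    rewrite ql (fP k ax); case: (hE k ax) => -> //.
    by rewrite -nE // -qC.
  by rewrite /R Cn' (negbTE nC) qC // eqxx.
(* Since [P m = P m'], rerouting does not affect [P], which is therefore flat on the unmixed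
   tree. *)
apply: trq.1; rewrite flat_cat fPB andbT; apply/allP => _ /mapP[k + ->] /=.
rewrite mem_enum => sk; rewrite (fP _ sk); case: (hE k sk) => -> //.
have [e|nk] := eqVneq (inl k) x0; first by rewrite e -/m -/m' Pm.
by rewrite -nE //; case: (qB (next (inl k))) => [->|[-> ->]]; rewrite ?Pm.
Qed.

End Trace.

Lemma mem_inner (A : category) (T : ashape A) (t : vertex T) :
  (t \in inner T) = ~~ is_leaf (symbol_at t).
Proof.
elim: T t => [x|T1 IH1 T2 IH2|T1 IH1] t //=.
  rewrite inE mem_cat; case: t => [[t|t]|] //=.
    rewrite (mem_map (f := Some \o inl)) ?IH1; last by move=> ? ? [].
    by rewrite [X in _ || X](_ : _ = false) ?orbF //; apply/mapP => -[].
  rewrite orbC (mem_map (f := Some \o inr)) ?IH2; last by move=> ? ? [].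
  by rewrite [X in _ || X](_ : _ = false) ?orbF //; apply/mapP => -[].
rewrite inE; case: t => [t|] //=.
by rewrite (mem_map (f := Some)) ?IH1 // => ? ? [].
Qed.

Lemma size_vertices (A : category) (T : ashape A) : size (vertices T) = #|vertex T|.
Proof.
elim: T => [x|T1 IH1 T2 IH2|T1 IH1] /=; first by rewrite card_unit.
  by rewrite card_option card_sum size_cat !size_map IH1 IH2.
by rewrite card_option size_map IH1.
Qed.

(** * Composition of linkings *)

Section Composition.
Variables (A : category) (S T U : ashape A).

(** Arranged as outside vertices plus interface, the form [K + T] of the trace lemmas. *)
Definition node : finType := (vertex2 S U + vertex T)%type.

Definition nodeST (v : vertex2 S T) : node :=
  match v with inl s => inl (inl s) | inr t => inr t end.

Definition nodeTU (v : vertex2 T U) : node :=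
  match v with inl t => inr t | inr u => inl (inr u) end.

Definition in3 (x : node) : vertex3 S T U :=
  match x with inl k => inSU T k | inr t => inl (inr t) end.

Definition node_symbol (x : node) : symbol A :=
  match x with inl k => symbol2 k | inr t => symbol_at t end.

Definition is_src (k : vertex2 S U) := is_leaf (symbol2 k) && sign2 k.

Lemma in3_ST v : in3 (nodeST v) = inST U v. Proof. by case: v. Qed.

Lemma in3_TU v : in3 (nodeTU v) = inTU S v. Proof. by case: v. Qed.

Lemma in3_inj : injective in3.
Proof. by move=> [[x|x]|x] [[y|y]|y] //= [->]. Qed.

Lemma node_symbolST v : node_symbol (nodeST v) = symbol2 v. Proof. by case: v. Qed.

Lemma node_symbolTU v : node_symbol (nodeTU v) = symbol2 v. Proof. by case: v. Qed.

(* Every leaf of [T] is a source of exactly one of [f] and [g]; the value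
   [child t] at the inner vertices comes from [tree_cut_shape]. *)
Definition next (f : leaf_function S T) (g : leaf_function T U) (x : node) : node :=
  let viaf v d := oapp (fun l : src S T => nodeST (val (f l))) d (insub v) in
  let viag v d := oapp (fun l : src T U => nodeTU (val (g l))) d (insub v) in
  match x with
  | inl (inl s) => viaf (inl s) x
  | inl (inr u) => viag (inr u) x
  | inr t => viaf (inr t) (viag (inl t) (inr (child t)))
  end.

Section Next.
Variables (f : leaf_function S T) (g : leaf_function T U).

Lemma next_ST (l : src S T) : next f g (nodeST (val l)) = nodeST (val (f l)).
Proof.
by have := valK l; case: (val l) => v /= ->.
Qed.

Lemma next_TU (l : src T U) : next f g (nodeTU (val l)) = nodeTU (val (g l)).
Proof.
have := valK l; have := valP l; case: (val l) => v /= p -> //=.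
by rewrite insubF //=; case/andP: p => _ ->; rewrite andbF.
Qed.

Lemma next_inner t : ~~ is_leaf (symbol_at t) -> next f g (inr t) = inr (child t).
Proof. by move=> n; rewrite /= !insubF //= (negbTE n). Qed.

Lemma activeP (x : node) : active is_src x ->
  [\/ exists l : src S T, x = nodeST (val l), exists l : src T U, x = nodeTU (val l)
    | exists2 t, x = inr t & ~~ is_leaf (symbol_at t)].
Proof.
case: x => [[s|u]|t] /= ax.
- by apply: Or31; exists (Sub (inl s : vertex2 S T) ax); rewrite SubK.
- by apply: Or32; exists (Sub (inr u : vertex2 T U) ax); rewrite SubK.
- have [lt|] := boolP (is_leaf (symbol_at t)); last by move=> n; apply: Or33; exists t.
  have [pt|nt] := boolP (positive t).
    have p : is_leaf (symbol2 (inl t : vertex2 T U)) && sign2 (inl t : vertex2 T U).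
      by rewrite /= lt pt.
    by apply: Or32; exists (Sub (inl t : vertex2 T U) p); rewrite SubK.
  have p : is_leaf (symbol2 (inr t : vertex2 S T)) && sign2 (inr t : vertex2 S T).
    by rewrite /= lt nt.
  by apply: Or31; exists (Sub (inr t : vertex2 S T) p); rewrite SubK.
Qed.

Lemma active_ST (l : src S T) : active is_src (nodeST (val l)).
Proof. by have := valP l; case: (val l). Qed.

Lemma active_TU (l : src T U) : active is_src (nodeTU (val l)).
Proof. by have := valP l; case: (val l). Qed.

End Next.

(** Both copies of [T] live in [W], and [q] glues them after cut elimination. No switch of [T]
    survives, so [d] ranges over [S] and [U] only. *)
Lemma tree_graph_edges (f : linking S T) (g : linking T U) (d : vertex2 S U -> bool) :
  tree (graph_edges is_src (next f g) (arcs2 d)).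
Proof.
pose dST dT (v : vertex2 S T) := match v with inl s => d (inl s) | inr t => dT t end.
pose dTU dT (v : vertex2 T U) := match v with inl t => dT t | inr u => d (inr u) end.
pose W : finType := (vertex2 S T + vertex2 T U)%type.
pose i (t : vertex T) : W := inl (inr t); pose j (t : vertex T) : W := inr (inl t).
pose B : seq (W * W) := emap (fun s => inl (inl s)) (arcs true (d \o inl)) ++
  emap (fun u => inr (inr u)) (arcs false (d \o inr)) ++
  emap inl (leaf_edges f) ++ emap inr (leaf_edges g).
have cut : tree ([seq (i v, j v) | v <- vertices T] ++
    [seq (i v, i (child v)) | v <- inner T] ++ B).
  (* [i] embeds [T] as the target shape of [f], whose negative tensors are switched. *)
  apply: (tree_cut_shape (p := false)) => dT dT'.
  have tf : tree (arcs2 (dST dT) ++ leaf_edges f).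
    by apply/switching_treeP; case: (linkingP f).
  have tg : tree (arcs2 (dTU dT') ++ leaf_edges g).
    by apply/switching_treeP; case: (linkingP g).
  apply: tree_change (tree_union (inr (root T)) (inl (root T)) tf tg) _ _ => [P|].
    by rewrite /arcs2; flat_solve.
  by rewrite /arcs2; size_solve.
pose q (w : W) : node := match w with inl v => nodeST v | inr v => nodeTU v end.
pose r (x : node) : W :=
  match x with
  | inl (inl s) => inl (inl s) | inl (inr u) => inr (inr u) | inr t => inl (inr t)
  end.
have rK : cancel r q by case=> [[]|].
have tq := tree_contract rK _ _ cut.
have {}tq : tree (emap q ([seq (i v, i (child v)) | v <- inner T] ++ B)).
  apply: tq; first by move=> _ /mapP[v _ ->].
  by rewrite size_map size_vertices !card_sum; lia.
have sub : forall P, flat P (graph_edges is_src (next f g) (arcs2 d)) ->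
    flat P (emap q ([seq (i v, i (child v)) | v <- inner T] ++ B)).
  move=> P /flat_graph_edges[h]; rewrite /arcs2 flat_cat !flat_map => /andP[h1 h2].
  rewrite /B !flat_cat !flat_map; apply/and5P; split=> //.
  - apply/allP => _ /mapP[t + ->] /=; rewrite mem_inner => nt.
    by rewrite -(next_inner f g nt) h.
  - by apply/allP => _ /mapP[l _ ->] /=; rewrite -(next_ST f g) h // active_ST.
  - by apply/allP => _ /mapP[l _ ->] /=; rewrite -(next_TU f g) h // active_TU.
(* Only an upper bound on the number of edges remains: each active node is an inner vertex of [T] or
   a source of [f] or [g]. *)
apply: tree_le; first by move=> P /sub; apply: tq.1.
rewrite -tq.2 ltnS /emap size_map !size_cat !size_map -!cardE.
have : size (enum (active (T := vertex T) is_src)) <= size (map (@inr (vertex2 S U) (vertex T)) (inner T) ++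
    map (nodeST \o val) (enum (src S T)) ++ map (nodeTU \o val) (enum (src T U))).
  apply: uniq_leq_size; first exact: enum_uniq.
  move=> x; rewrite mem_enum !mem_cat => /activeP[[l ->]|[l ->]|[t -> nt]].
  - by rewrite (map_f (nodeST \o val)) ?orbT // mem_enum.
  - by rewrite (map_f (nodeTU \o val)) ?orbT // mem_enum.
  - by rewrite map_f // mem_inner.
rewrite !size_cat !size_map -!cardE; lia.
Qed.

End Composition.

(** Used to select labels: arrows form a bare [Type], and finiteness of the index makes choice an
    induction. *)
Lemma fin_choice (I : finType) (X : Type) (x0 : X) (P : I -> X -> Prop) :
  (forall i, exists x, P i x) -> exists F : I -> X, forall i, P i (F i).
Proof.
move=> h; suff [F hF] : exists F, forall i, i \in enum I -> P i (F i).
  by exists F => i; apply: hF; rewrite mem_enum.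
elim: (enum I) => [|i s [F hF]]; first by exists (fun=> x0).
have [x Px] := h i; exists (fun j => if j == i then x else F j) => j.
by rewrite inE; case: eqP => [->|_ /hF].
Qed.

(** * Paths through the interface and their labels *)

Section Composite.
Variables (A : category) (S T U : ashape A) (f : linking S T) (g : linking T U).
Local Notation node := (node S T U).
Local Notation nx := (next f g).
Local Notation in3 := (@in3 A S T U).

(** Inner vertices of [T] are active too, but their edge to [child] is auxiliary and belongs neither
    to [f] nor to [g]. *)
Definition src_node (x : node) :=
  active (T := vertex T) (@is_src A S U) x && is_leaf (node_symbol x).

Definition edge_label (x : node) : option (arrow A) :=
  let viaf v d := oapp (fun l : src S T => label f l) d (insub v) in
  let viag v d := oapp (fun l : src T U => label g l) d (insub v) in
  match x with
  | inl (inl s) => viaf (inl s) None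
  | inl (inr u) => viag (inr u) None
  | inr t => viaf (inr t) (viag (inl t) None)
  end.

Lemma edge_label_ST (l : src S T) : edge_label (nodeST U (val l)) = label f l.
Proof. by have := valK l; case: (val l) => v /= ->. Qed.

Lemma edge_label_TU (l : src T U) : edge_label (nodeTU S (val l)) = label g l.
Proof.
have := valK l; have := valP l; case: (val l) => v /= p -> //=.
by rewrite insubF //=; case/andP: p => _ ->; rewrite andbF.
Qed.

Lemma src_nodeP (x : node) : src_node x ->
  (exists l : src S T, x = nodeST U (val l)) \/ (exists l : src T U, x = nodeTU S (val l)).
Proof.
case/andP => /activeP[[l ->]|[l ->]|[t -> /= nt]]; [by left; exists l|by right; exists l|].
by rewrite (negbTE nt).
Qed.

Lemma src_node_ST (l : src S T) : src_node (nodeST U (val l)).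
Proof. by rewrite /src_node active_ST node_symbolST; case/andP: (valP l). Qed.

Lemma src_node_TU (l : src T U) : src_node (nodeTU S (val l)).
Proof. by rewrite /src_node active_TU node_symbolTU; case/andP: (valP l). Qed.

Lemma union_edgeP v o w : union_edge f g v o w <->
  exists x, [/\ src_node x, v = in3 x, o = edge_label x & w = in3 (nx x)].
Proof.
split=> [[l|l]|[x [/src_nodeP[[l ->]|[l ->]] -> -> ->]]].
- exists (nodeST U (val l)).
  by rewrite src_node_ST edge_label_ST next_ST !in3_ST.
- exists (nodeTU S (val l)).
  by rewrite src_node_TU edge_label_TU next_TU !in3_TU.
- by rewrite edge_label_ST next_ST !in3_ST; constructor.
- by rewrite edge_label_TU next_TU !in3_TU; constructor.
Qed.

Lemma next_leaf x : src_node x -> is_leaf (node_symbol (nx x)).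
Proof.
case/src_nodeP => -[l ->]; rewrite ?next_ST ?next_TU ?node_symbolST ?node_symbolTU.
  by case/andP: (valP (f l)).
by case/andP: (valP (g l)).
Qed.

(** Edges end at leaves of the sign opposite to that of sources, so a path reaching [S] or [U] stops
    there. *)
Lemma next_outside x k : src_node x -> nx x = inl k -> ~~ is_src k.
Proof.
rewrite /is_src negb_and; case/src_nodeP => -[l ->]; rewrite ?next_ST ?next_TU.
  by have /andP[_] := valP (f l); case: (val (f l)) => //= s ns [<-] /=; rewrite ns orbT.
by have /andP[_] := valP (g l); case: (val (g l)) => //= s ns [<-] /=; rewrite ns orbT.
Qed.

Lemma next_src_node x t : src_node x -> nx x = inr t -> src_node (inr t).
Proof. by move=> /next_leaf + e; rewrite e /src_node. Qed.

Lemma next_gen x a : src_node x -> node_symbol x = SAtom (Gen a) ->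
  exists b (z : hom a b),
    node_symbol (nx x) = SAtom (Gen b) /\ edge_label x = Some (Arrow z).
Proof.
case/src_nodeP => -[l ->].
  rewrite node_symbolST edge_label_ST next_ST node_symbolST => la.
  have [[fg _ _] fw _] := linkingP f.
  have := fg l; rewrite la => /(_ isT); case fb: (symbol2 (val (f l))) => [[b|]| |] // _.
  by have [z ?] := fw _ _ _ la fb; exists b, z.
rewrite node_symbolTU edge_label_TU next_TU node_symbolTU => la.
have [[fg _ _] fw _] := linkingP g.
have := fg l; rewrite la => /(_ isT); case fb: (symbol2 (val (g l))) => [[b|]| |] // _.
by have [z ?] := fw _ _ _ la fb; exists b, z.
Qed.

Lemma edge_label_some x : src_node x -> isSome (edge_label x) = is_gen (node_symbol x).
Proof.
case/src_nodeP => -[l ->].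
  by rewrite edge_label_ST node_symbolST; apply/eqP/(forallP (labelP f)).
by rewrite edge_label_TU node_symbolTU; apply/eqP/(forallP (labelP g)).
Qed.

(** Edges are deterministic and neither path can be prolonged, so neither is a proper prefix of the
    other. *)
Lemma union_path_uniq v s w s' w' :
    union_path f g v s w -> union_path f g v s' w' ->
    (forall o z, ~ union_edge f g w o z) -> (forall o z, ~ union_edge f g w' o z) ->
  s = s' /\ w = w'.
Proof.
have det u o z o' z' : union_edge f g u o z -> union_edge f g u o' z' -> o = o' /\ z = z'.
  move=> /union_edgeP[x [_ -> -> ->]] /union_edgeP[y [_ /in3_inj -> -> ->]] //.
move=> p; elim: p s' w' => {v s w} [v o w e|u o v s w e p IH] s' w' p' nw nw'.
  case: p' e nw' => [v' o' w2 e'|u o' v' s2 w2 e' p2] e nw'.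
    by have [-> ->] := det _ _ _ _ _ e e'.
  have [_ E] := det _ _ _ _ _ e e'; subst v'.
  by case: p2 nw nw' => [? ? ? e2|? ? ? ? ? e2 _] nw; case: (nw _ _ e2).
case: p' e nw' => [v' o' w2 e'|u' o' v' s2 w2 e' p2] e nw'.
  have [_ E] := det _ _ _ _ _ e e'; subst w2.
  by case: p nw' {IH nw} => [? ? ? e2|? ? ? ? ? e2 _] nw'; case: (nw' _ _ e2).
have [-> E] := det _ _ _ _ _ e e'; subst v'.
by have [-> ->] := IH _ _ p2 nw nw'.
Qed.

Section Exit.
Variable q : node -> vertex2 S U.
Hypothesis qE : is_exit nx q.

(** Intermediate nodes of a path lie in [T] by [next_outside], and there [q] is invariant under
    [next]. *)
Lemma union_path_exit v s w : union_path f g v s w ->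
  exists x y, [/\ src_node x, v = in3 x, w = in3 y & q (nx x) = q y].
Proof.
elim=> {v s w} [v o w /union_edgeP[x [sx -> _ ->]]|u o v s w /union_edgeP[x [sx -> _ ->]] _].
  by exists x, (nx x).
move=> [x' [y [sx' /in3_inj E -> e]]]; exists x, y; split=> //; rewrite -{y}e.
case: x' E sx' => [k|t] E sx'; last by rewrite E (proj2 qE).
have := next_outside sx E; case/andP: sx' => /= sk _; by rewrite sk.
Qed.

(** Induction along the trace from [nx x]. After a generator all leaves are generators, so the
    labels compose; after a unit the first edge is already unlabelled. *)
Lemma exit_path x : src_node x ->
  [/\ is_leaf (symbol2 (q (nx x))), ~~ is_src (q (nx x)) &
   exists s, union_path f g (in3 x) s (in3 (inl (q (nx x)))) /\
   exists o, [/\ composite_label s o, isSome o = is_gen (node_symbol x) &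
     forall a, node_symbol x = SAtom (Gen a) ->
     exists b (z : hom a b), symbol2 (q (nx x)) = SAtom (Gen b) /\ o = Some (Arrow z)]].
Proof.
have [qk qt] := qE.
move: {-2}(nx x) (erefl (nx x)) => y; move: y x.
apply: (trace_ind (tree_graph_edges f g (fun=> true))) => [k|t IH] x E sx.
  rewrite qk; split.
  - by have := next_leaf sx; rewrite -E.
  - exact: next_outside sx (esym E).
  - exists [:: edge_label x]; split.
      by constructor; apply/union_edgeP; exists x; rewrite -E.
    exists (edge_label x); split; last 1 first.
    + by move=> a /(next_gen sx)[b [z [eb ->]]]; exists b, z; rewrite -E in eb.
    + have := edge_label_some sx; case xs: (node_symbol x) => [[a|]| |] /=.
      * have [b [z [_ ->]]] := next_gen sx xs.
        by move=> _; apply: (composite_labelled (s := [:: _])); constructor.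
      * by case: (edge_label x) => // _; apply: composite_unlabelled.
      * by case: (edge_label x) => // _; apply: composite_unlabelled.
      * by case: (edge_label x) => // _; apply: composite_unlabelled.
    + exact: edge_label_some.
have st := next_src_node sx (esym E).
have [l1 l2 [s [p [o [co so go]]]]] := IH (inr t) erefl st.
rewrite qt; split=> //; exists (edge_label x :: s); split.
  by apply: union_pathS p; apply/union_edgeP; exists x; rewrite -E.
have := edge_label_some sx; case xs: (node_symbol x) => [[a|]| |] /= els.
- have [b [z [eb ze]]] := next_gen sx xs; rewrite -E in eb.
  have [c [z' [ec oe]]] := go _ eb; exists (Some (Arrow (compm z z'))); split=> //.
    rewrite ze; move: co; rewrite oe => co.
    inversion co as [s1 z1 cs E1 E2|]; subst.
    by apply: (composite_labelled (s := Arrow z :: s1)); constructor.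
  by move=> a' [?]; subst a'; exists c, (compm z z').
- exists None; split=> //; apply: composite_unlabelled.
  by move: els; case: (edge_label x).
- exists None; split=> //; apply: composite_unlabelled.
  by move: els; case: (edge_label x).
- exists None; split=> //; apply: composite_unlabelled.
  by move: els; case: (edge_label x).
Qed.

Lemma composite_exit (h : linking S U) (l : src S U) :
  is_composite f g h -> val (h l) = q (nx (inl (val l))).
Proof.
move=> [hc _]; have [s p] := (hc l _).1 erefl.
have [x [y [_ Ex Ey e]]] := union_path_exit p.
have xl : in3 x = in3 (inl (val l)) by rewrite -Ex.
have ym : in3 y = in3 (inl (val (h l))) by rewrite -Ey.
by rewrite -(in3_inj xl) e (in3_inj ym) (proj1 qE).
Qed.

End Exit.
End Composite.

Lemma tree_leaf_edges (A : category) (S T : ashape A) (m : leaf_function S T) r d :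
  (forall l, val (m l) = r (val l)) ->
  tree ([seq (k, r k) | k <- enum (@is_src A S T)] ++ arcs2 d) ->
  tree (arcs2 d ++ leaf_edges m).
Proof.
move=> mr tr; apply: tree_change tr _ _ => [P|].
  rewrite !flat_cat andbC => /andP[/allP h ->]; rewrite andbT.
  apply/allP => _ /mapP[k + ->]; rewrite mem_enum => sk /=.
  have [l <-] : exists l : src S T, val l = k by exists (Sub k sk); rewrite SubK.
  by rewrite -mr; apply: (h (_, _)); apply/mapP; exists l; rewrite ?mem_enum.
rewrite !size_cat !size_map -!cardE addnC; congr (_ + _).
by rewrite -enumT -cardE card_sig; apply: eq_card => k; rewrite inE.
Qed.

(** * Bijectivity on generators *)

Section Generators.
Variables (A : category) (S T U : ashape A) (f : linking S T) (g : linking T U).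
Local Notation node := (node S T U).
Local Notation nx := (next f g).
Variable q : node -> vertex2 S U.
Hypothesis qE : is_exit nx q.

Definition gen_src (x : node) := src_node x && is_gen (node_symbol x).

Lemma next_gen_inj : {in gen_src &, injective nx}.
Proof.
(* Edges of [f] enter [T] at positive leaves, edges of [g] at negative ones. *)
have cross (l : src S T) (l' : src T U) : nx (nodeST U (val l)) <> nx (nodeTU S (val l')).
  rewrite next_ST next_TU; have /andP[_] := valP (f l); have /andP[_] := valP (g l').
  case: (val (f l)) => s; case: (val (g l')) => u //= a b [e]; subst.
  by rewrite a in b.
have stI : injective (@nodeST A S T U) by move=> [?|?] [?|?] //= [->].
have tuI : injective (@nodeTU A S T U) by move=> [?|?] [?|?] //= [->].
have [[_ fi _] _ _] := linkingP f; have [[_ gi _] _ _] := linkingP g.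
move=> x y /andP[/src_nodeP hx gx] /andP[/src_nodeP hy gy].
case: hx gx => -[l ->]; case: hy gy => -[l' ->]; rewrite ?node_symbolST ?node_symbolTU => gy gx.
- by rewrite !next_ST => /stI /val_inj /fi ->.
- by move=> /cross.
- by move=> /esym /cross.
- by rewrite !next_TU => /tuI /val_inj /gi ->.
Qed.

Lemma next_gen_surj (y : node) : is_gen (node_symbol y) ->
  (if y is inl k then ~~ sign2 k else true) -> exists2 x, gen_src x & nx x = y.
Proof.
have [[_ _ fs] _ _] := linkingP f; have [[_ _ gs] _ _] := linkingP g.
have viaf (v : vertex2 S T) : is_gen (symbol2 v) -> ~~ sign2 v ->
    exists2 x, gen_src x & nx x = nodeST U v.
  move=> gv nv; have p : is_leaf (symbol2 v) && ~~ sign2 v.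
    by rewrite nv andbT; case: (symbol2 v) gv.
  have [|l gl e] := fs (Sub v p); first by rewrite SubK.
  exists (nodeST U (val l)); last by rewrite next_ST e SubK.
  by rewrite /gen_src src_node_ST node_symbolST.
have viag (v : vertex2 T U) : is_gen (symbol2 v) -> ~~ sign2 v ->
    exists2 x, gen_src x & nx x = nodeTU S v.
  move=> gv nv; have p : is_leaf (symbol2 v) && ~~ sign2 v.
    by rewrite nv andbT; case: (symbol2 v) gv.
  have [|l gl e] := gs (Sub v p); first by rewrite SubK.
  exists (nodeTU S (val l)); last by rewrite next_TU e SubK.
  by rewrite /gen_src src_node_TU node_symbolTU.
case: y => [[s|u]|t] gy sy.
- exact: (viaf (inl s)).
- exact: (viag (inr u)).
- have [pt|nt] := boolP (positive t); last exact: (viag (inl t)).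
  by apply: (viaf (inr t)); rewrite //= negbK.
Qed.

(* [next] maps the generators exiting at [m] bijectively onto [m] together with those
   of them that lie in [T], so exactly one of them lies outside [T]. *)
Lemma gen_exit_unique (m : vertex2 S U) : is_gen (symbol2 m) -> ~~ sign2 m ->
  exists k0, forall k, gen_src (inl k) && (q (nx (inl k)) == m) = (k == k0).
Proof.
have [qk qt] := qE; move=> gm sm.
pose R := [set x : node | gen_src x && (q (nx x) == m)].
pose TT := [set x : node | if x is inr _ then true else false].
have im : nx @: R = inl m |: (R :&: TT).
  apply/setP => y; apply/imsetP/setU1P => [[x]|].
    rewrite inE => /andP[/andP[sx gx] /eqP qx] ->.
    case e: (nx x) => [k|t]; first by left; rewrite -qx e qk.
    right; rewrite !inE andbT -e; have st := next_src_node sx e.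
    case xs: (node_symbol x) gx => [[a|]| |] // _.
    have [b [_ [eb _]]] := next_gen f g sx xs.
    by rewrite /gen_src eb e st /= -qt -e qx.
  case=> [->|]; first have [x gx e] := @next_gen_surj (inl m) gm sm.
    by exists x; rewrite // inE gx e qk eqxx.
  rewrite !inE; case: y => [k|t]; rewrite ?andbF // andbT => /andP[/andP[_ gt] qm].
  have [x gx e] := @next_gen_surj (inr t) gt isT.
  by exists x; rewrite // inE gx e qt.
have cR : #|R| = (#|R :&: TT|).+1.
  rewrite -(card_in_imset (f := nx) (D := R)) ?im.
    by rewrite cardsU1 !inE /= andbF.
  by move=> x y; rewrite !inE => /andP[gx _] /andP[gy _]; apply: next_gen_inj.
have : #|R :\: TT| == 1.
  by rewrite -(eqn_add2l #|R :&: TT|) cardsID cR addn1.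
case/cards1P => -[k0|t] e; last first.
  have : inr t \in R :\: TT by rewrite e set11.
  by rewrite !inE.
exists k0 => k; have : (inl k \in R :\: TT) = (inl k == inl k0 :> node).
  by rewrite e inE.
by rewrite !inE.
Qed.

End Generators.

(** The composite sends a source to the exit of its trace; [tree_trace] provides its switchings and
    [gen_exit_unique] the bijection on generators. *)
Lemma composite_exists (A : category) (S T U : ashape A)
    (f : linking S T) (g : linking T U) :
  exists h : linking S U, is_composite f g h.
Proof.
(* [next] is the same for all switchings, so one of them suffices to obtain [q]. *)
have [q qE] := exit_exists (tree_graph_edges f g (fun=> true)).
pose nx := next f g.
have sn (l : src S U) : src_node (inl (val l) : node S T U).
  by rewrite /src_node /= /is_src (valP l); case/andP: (valP l).
have qtgt (l : src S U) :
    is_leaf (symbol2 (q (nx (inl (val l))))) && ~~ sign2 (q (nx (inl (val l)))).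
  have [ql + _] := exit_path qE (sn l).
  by rewrite /is_src ql.
have nout (l : tgt S U) o z : ~ union_edge f g (inSU T (val l)) o z.
  move=> /union_edgeP[x [sx e _ _]].
  have xl : in3 x = in3 (inl (val l) : node S T U) by rewrite -e.
  move: sx; rewrite (in3_inj xl) /src_node /= /is_src.
  by have /andP[-> /negbTE ->] := valP l.
pose tg (l : src S U) : tgt S U := Sub (q (nx (inl (val l)))) (qtgt l).
have vtg l : val (tg l) = q (nx (inl (val l))) by rewrite SubK.
have ex l : exists o : option (arrow A),
   [/\ exists s, union_path f g (inSU T (val l)) s (inSU T (val (tg l))),
    forall s, union_path f g (inSU T (val l)) s (inSU T (val (tg l))) ->
      composite_label s o, isSome o = is_gen (symbol2 (val l)) &
    forall a, symbol2 (val l) = SAtom (Gen a) -> exists b (z : hom a b),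
      symbol2 (val (tg l)) = SAtom (Gen b) /\ o = Some (Arrow z)].
  have [_ _ [s [p [o [co so go]]]]] := exit_path qE (sn l).
  rewrite -/nx -vtg in p go; exists o; split=> //; first by exists s.
  (* All paths between these ends coincide, so the label found for one fits all. *)
  by move=> s' p'; have [<-] := union_path_uniq p p' (@nout _) (@nout _).
have [lb lbP] := fin_choice None ex.
have labP : [forall l, isSome ([ffun l => lb l] l) == is_gen (symbol2 (val l))].
  by apply/forallP => l; rewrite ffunE; have [_ _ -> _] := lbP l.
pose h0 := @LeafFunction A S U [ffun l => tg l] [ffun l => lb l] labP.
have gens : gen_bijection h0.
  have uniq_src m := gen_exit_unique qE (m := m).
  have gsrc (l : src S U) : is_gen (symbol2 (val l)) -> gen_src (inl (val l) : node S T U).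
    by rewrite /gen_src sn.
  have gtgt (l : src S U) : is_gen (symbol2 (val l)) -> is_gen (symbol2 (val (tg l))).
    case ls: (symbol2 (val l)) => [[a|]| |] // _.
    by have [_ _ _ /(_ _ ls)[b [z [-> _]]]] := lbP l.
  split=> [l|l1 l2 g1 g2|m gm] /=; rewrite ?ffunE; first exact: gtgt.
    move=> e; have /andP[_ st] := valP (tg l1).
    have [k0 hk] := uniq_src _ (gtgt _ g1) st.
    have := hk (val l1); have := hk (val l2).
    rewrite !gsrc // !andTb -!vtg -e !eqxx => /esym /eqP e2 /esym /eqP e1.
    by apply: val_inj; rewrite e1 e2.
  have /andP[_ sm] := valP m; have [k0 hk] := uniq_src _ gm sm.
  have := hk k0; rewrite eqxx => /andP[/andP[/andP[sk _] gk] /eqP qk].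
  exists (Sub k0 sk); first by rewrite SubK.
  by rewrite ffunE; apply: val_inj; rewrite vtg SubK.
have lab0 : well_labelled h0.
  move=> l a b la; rewrite /= !ffunE => lb'.
  have [_ _ _ /(_ _ la)[b' [z [eb ->]]]] := lbP l.
  by move: eb; rewrite lb' => -[e]; subst b'; exists z.
have lk : is_linking h0.
  split=> // d; apply/switching_treeP.
  apply: (tree_leaf_edges (r := fun k => q (nx (inl k)))).
    by move=> l; rewrite /= ffunE vtg.
  exact: (tree_trace qE) (tree_graph_edges f g d).
exists (Linking lk); split=> [l m|l s] /=; rewrite !ffunE.
  have [exs _ _ _] := lbP l; split=> [<- //|[s p]].
  have [s' p'] := exs.
  have [_ E] := union_path_uniq p' p (@nout _) (@nout _).
  have e2 : in3 (inl (val (tg l)) : node S T U) = in3 (inl (val m)) by [].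
  by apply: val_inj; case: (in3_inj e2).
by have [_ h _ _] := lbP l; apply: h.
Qed.

(** * Rewiring *)

(** Induction on the number of differing edges. Moving one of them gives a mixture, hence a linking
    similar to [h] and closer to [h']. *)
Lemma equivalent_of_mixtures (A : category) (S T : ashape A) (h h' : linking S T) :
    label h = label h' -> (forall l, h l <> h' l -> is_unit (symbol2 (val l))) ->
    (forall m : leaf_function S T, (forall l, m l = h l \/ m l = h' l) ->
      forall d, tree (arcs2 d ++ leaf_edges m)) ->
  equivalent h h'.
Proof.
have [n] := ubnP #|[set l | h l != h' l]|; elim: n h => // n IH h lt lE un mix.
have [d0|] := set_0Vmem [set l | h l != h' l].
  have -> : h = h'; last exact: rst_refl.
  apply/linking_eq/leaf_function_eq; last by rewrite lE.
  move=> l; apply/eqP; have : l \notin [set l | h l != h' l] by rewrite d0 inE.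
  by rewrite inE negbK.
case=> l0; rewrite inE => /eqP ne.
pose m0 := @LeafFunction A S T [ffun l => if l == l0 then h' l else h l] (label h) (labelP h).
have m0E l : m0 l = if l == l0 then h' l else h l by rewrite /= ffunE.
have u0 := un _ ne.
(* The moved edge starts at a unit, so the conditions on generators are inherited from [h]. *)
have gE l : is_gen (symbol2 (val l)) -> m0 l = h l.
  by move=> gl; rewrite m0E; case: eqP => // e; rewrite e in gl; case: (symbol2 (val l0)) u0 gl => [[]| |].
have lk : is_linking m0.
  have [[g1 g2 g3] wl _] := linkingP h; split.
  - split=> [l gl|l1 l2 gl1 gl2|m /g3[l gl e]].
    + by rewrite gE //; apply: g1.
    + by rewrite !gE //; apply: g2.
    + by exists l; rewrite ?gE.
  - by move=> l a b la; rewrite gE ?la //; apply: wl.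
  - move=> d; apply/switching_treeP/mix => l; rewrite m0E.
    by case: eqP; [right|left].
have mE l : Linking lk l = if l == l0 then h' l else h l := m0E l.
apply: (@rst_trans _ _ _ (Linking lk)).
  apply: rst_step; exists l0; split=> //=.
  - by rewrite ffunE eqxx.
  - by move=> l /eqP /negbTE nl; rewrite ffunE nl.
apply: IH => //.
- rewrite ltnS in lt; apply: leq_trans lt.
  rewrite (cardsD1 l0 [set l | h l != h' l]).
  rewrite inE (introN eqP ne) add1n ltnS; apply: subset_leq_card.
  by apply/subsetP => l; rewrite !inE mE; have [->|] := eqVneq l l0; rewrite ?eqxx.
- by move=> l; rewrite mE; case: eqP => // _; apply: un.
(* Mixtures of the new linking with [h'] are already mixtures of [h] and [h']. *)
- move=> m hm; apply: mix => l; have := hm l; rewrite mE.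
  by case: (l == l0) => -[]; auto.
Qed.

Section Rewiring.
Variables (A : category) (S T U : ashape A).
Variables (f f' : linking S T) (g g' : linking T U) (x0 : node S T U).
Hypotheses (sx0 : src_node x0) (ux0 : is_unit (node_symbol x0)).
Hypothesis nextE : forall x, x != x0 -> next f g x = next f' g' x.
Hypothesis labelE : edge_label f g =1 edge_label f' g'.

(** A path from a generator visits generators only, hence avoids the unit [x0]. *)
Lemma gen_path_rewire v s w : union_path f g v s w ->
  forall x, v = in3 x -> is_gen (node_symbol x) -> union_path f' g' v s w.
Proof.
have edge x o w' : is_gen (node_symbol x) -> union_edge f g (in3 x) o w' ->
    [/\ union_edge f' g' (in3 x) o w', w' = in3 (next f g x)
      & is_gen (node_symbol (next f g x))].
  move=> gx /union_edgeP[y [sy /in3_inj ey -> ->]]; subst y; split=> //.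
    apply/union_edgeP; exists x; rewrite labelE nextE //.
    by apply: contraTneq gx => ->; case: (node_symbol x0) ux0 => [[]| |].
  case xs: (node_symbol x) gx => [[a|]| |] // _.
  by have [b [z [-> _]]] := next_gen f g sy xs.
elim=> {v s w} [v o w e|u o v s w e _ IH] x vx gx; subst.
  by apply: union_path1; have [] := edge _ _ _ gx e.
have [e' vE gn] := edge _ _ _ gx e.
exact: union_pathS e' (IH _ vE gn).
Qed.

(** Stated through [next], so that a change in either factor is covered. Composite edges from
    generators agree, the others are unlabelled on both sides, and [tree_mixture] handles the
    mixtures. *)
Lemma equivalent_rewire (h h' : linking S U) :
  is_composite f g h -> is_composite f' g' h' -> equivalent h h'.
Proof.
move=> hc hc'.
have genE l : is_gen (symbol2 (val l)) -> h l = h' l /\ label h l = label h' l.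
  move=> gl; have [s p] := (hc.1 l _).1 erefl.
  have p' := gen_path_rewire p (x := inl (val l)) erefl gl.
  have e : h' l = h l by apply/(hc'.1 l (h l)); exists s.
  split=> //; apply: composite_label_fun (hc.2 l s p) _.
  by apply: hc'.2; rewrite e.
have [q qE] := exit_exists (tree_graph_edges f g (fun=> true)).
have [q' qE'] := exit_exists (tree_graph_edges f' g' (fun=> true)).
apply: equivalent_of_mixtures => [|l ne|m hm d].
- apply/ffunP => l; have [/genE[]//|ng] := boolP (is_gen (symbol2 (val l))).
  have := forallP (labelP h) l; have := forallP (labelP h') l; rewrite (negbTE ng).
  by case: (label h l) => //; case: (label h' l).
- have /andP[] := valP l; case ls: (symbol2 (val l)) => [[a|]| |] // _ _.
  by case: ne; apply: (genE l _).1; rewrite ls.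
(* [r] extends [m] to all vertices, with the filler [k] outside the sources. *)
- pose r k := if insub k is Some l then val (m l) else k.
  apply: (tree_leaf_edges (r := r)) => [l|]; first by rewrite /r valK.
  apply: (tree_mixture qE qE' _ nextE (tree_graph_edges f g d) (tree_graph_edges f' g' d)).
    by case/andP: sx0.
  move=> k sk; rewrite /r; case: insubP => [l _ <-|]; last by rewrite [_ && _]sk.
  by rewrite -(composite_exit qE l hc) -(composite_exit qE' l hc'); case: (hm l) => ->; auto.
Qed.

End Rewiring.

(** * Compatibility with similarity and equivalence *)

Lemma similar_composite_l (A : category) (S T U : ashape A)
    (f f' : linking S T) (g : linking T U) (h h' : linking S U) :
  similar f f' -> is_composite f g h -> is_composite f' g h' -> equivalent h h'.
Proof.
move=> [l0 [u0 _ fE lE]]; apply: (@equivalent_rewire _ _ _ _ _ _ _ _ (nodeST U (val l0))).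
- exact: src_node_ST.
- by rewrite node_symbolST.
- have fE' v d : nodeST U v != nodeST U (val l0) ->
      oapp (fun l : src S T => nodeST U (val (f l))) d (insub v) =
      oapp (fun l : src S T => nodeST U (val (f' l))) d (insub v).
    by case: insubP => //= l _ <- n; rewrite fE // => e; rewrite e eqxx in n.
  by case=> [[s|u]|t] nx //; apply: fE'.
- by move=> x; rewrite /edge_label lE.
Qed.

Lemma similar_composite_r (A : category) (S T U : ashape A)
    (f : linking S T) (g g' : linking T U) (h h' : linking S U) :
  similar g g' -> is_composite f g h -> is_composite f g' h' -> equivalent h h'.
Proof.
move=> [l0 [u0 _ gE lE]]; apply: (@equivalent_rewire _ _ _ _ _ _ _ _ (nodeTU S (val l0))).
- exact: src_node_TU.
- by rewrite node_symbolTU.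
- have gE' v d : nodeTU S v != nodeTU S (val l0) ->
      oapp (fun l : src T U => nodeTU S (val (g l))) d (insub v) =
      oapp (fun l : src T U => nodeTU S (val (g' l))) d (insub v).
    by case: insubP => //= l _ <- n; rewrite gE // => e; rewrite e eqxx in n.
  case=> [[s|u]|t] nx //; first exact: gE'.
  by rewrite /next (gE' (inl t)).
- by move=> x; rewrite /edge_label lE.
Qed.

(** All composites are quantified over, so that transitivity can pass through the composite of the
    intermediate linking. *)
Lemma equivalent_composite_l (A : category) (S T U : ashape A)
    (f f' : linking S T) (g : linking T U) : equivalent f f' ->
  forall h h' : linking S U, is_composite f g h -> is_composite f' g h' -> equivalent h h'.
Proof.
elim=> {f f'} [f f' s h h'|f h h' hc hc'|f f' _ IH h h' hc hc'|f f1 f' _ IH _ IH' h h' hc hc'].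
- exact: similar_composite_l s.
- by rewrite (is_composite_uniq hc hc'); apply: rst_refl.
- exact/rst_sym/IH.
- have [h1 hc1] := composite_exists f1 g.
  exact: rst_trans (IH _ _ hc hc1) (IH' _ _ hc1 hc').
Qed.

Lemma equivalent_composite_r (A : category) (S T U : ashape A)
    (f : linking S T) (g g' : linking T U) : equivalent g g' ->
  forall h h' : linking S U, is_composite f g h -> is_composite f g' h' -> equivalent h h'.
Proof.
elim=> {g g'} [g g' s h h'|g h h' hc hc'|g g' _ IH h h' hc hc'|g g1 g' _ IH _ IH' h h' hc hc'].
- exact: similar_composite_r s.
- by rewrite (is_composite_uniq hc hc'); apply: rst_refl.
- exact/rst_sym/IH.
- have [h1 hc1] := composite_exists f g1.
  exact: rst_trans (IH _ _ hc hc1) (IH' _ _ hc1 hc').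
Qed.

Theorem theorem2 (A : category) (S T U : ashape A)
    (f f' : linking S T) (g g' : linking T U) :
  equivalent f f' -> equivalent g g' ->
  exists h h' : linking S U,
    [/\ is_composite f g h, is_composite f' g' h' & equivalent h h'].
Proof.
(* The factors are exchanged one after the other, with [f';g] in between. *)
move=> ef eg; have [h hc] := composite_exists f g.
have [h1 hc1] := composite_exists f' g; have [h' hc'] := composite_exists f' g'.
exists h, h'; split=> //; apply: rst_trans (equivalent_composite_l ef hc hc1) _.
exact (equivalent_composite_r eg hc1 hc').
Qed.
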